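(* Assume that $H:\mathbb{R}^3\to\mathbb{R}$ satisfies (A0)-(A5) and either (B-i) or (B-ii) (all listed in the context). Then for every $p\in\mathbb{R}$ and $\alpha=L,R$, there exists a unique $\lambda\in\mathbb{R}$ such that there exists a bounded solution $v^\alpha$ of $$\begin{cases}v^\alpha_t+H_\alpha(t,x,p+v^\alpha_x)=\lambda\quad\text{in }\mathbb{R}\times\mathbb{R},\\ v^\alpha\text{ is $\mathbb{Z}^2$-periodic (in $(t,x)$)}.\end{cases}$$ If $\bar H_\alpha(p)$ denotes such a $\lambda$, then the map $p\mapsto\bar H_\alpha(p)$ is continuous, coercive and quasi-convex.
   Context: Assumptions on $H=H(t,x,p)$. (A0) $H:\mathbb{R}^3\to\mathbb{R}$ is continuous. (A1) $H(t+k,x,p)=H(t,x,p)$ for all $k\in\mathbb{Z}$, $(t,x,p)\in\mathbb{R}^3$. (A2) There is a modulus of continuity $\omega$ such that $H(t,x,p)-H(s,x,p)\le\omega\big(|t-s|(1+\max(H(s,x,p),0))\big)$ for all $t,s,x,p\in\mathbb{R}$. (A3) $\lim_{|q|\to+\infty}H(t,x,q)=+\infty$ uniformly in $(t,x)$. (A4) There is $\rho_0>0$ such that for all $x\in\mathbb{R}\setminus(-\rho_0,\rho_0)$ there is a continuous map $t\mapsto p^0(t,x)$ such that $H(t,x,\cdot)$ is non-increasing on $(-\infty,p^0(t,x))$ and non-decreasing on $(p^0(t,x),+\infty)$. (A5) There are two Hamiltonians $H_L,H_R$ such that $H(t,x+k,p)-H_L(t,x,p)\to0$ as $\mathbb{Z}\ni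 k\to-\infty$ and $H(t,x+k,p)-H_R(t,x,p)\to0$ as $\mathbb{Z}\ni k\to+\infty$, uniformly in $(t,x,p)\in[0,1]^2\times\mathbb{R}$, and $H_\alpha(t+k,x+j,p)=H_\alpha(t,x,p)$ for all $k,j\in\mathbb{Z}$, $(t,x,p)\in\mathbb{R}^3$, $\alpha\in\{L,R\}$. (B-i) For each $\alpha=L,R$, $H_\alpha$ does not depend on time and there is $p^0_\alpha$ (independent of $(t,x)$) such that $H_\alpha(x,\cdot)$ is non-increasing on $(-\infty,p^0_\alpha)$ and non-decreasing on $(p^0_\alpha,+\infty)$. (B-ii) For each $\alpha=L,R$ and all $(t,x)$, $p\mapsto H_\alpha(t,x,p)$ is convex. Viscosity solutions. For a locally bounded function $u$, $u^*$ and $u_*$ are its upper and lower semi-continuous envelopes. $u$ is a sub-solution (resp. super-solution) of an equation if, whenever a $C^1$ test function $\varphi$ touches $u^*$ from above (resp. $u_*$ from below) at a point, $\varphi$ satisfies the equation at that point with $\le$ (resp. $\ge$). A solution is both; solutions may be discontinuous. A function $\bar H$ is coercive if $\bar H(p)\to+\infty$ as $|p|\to+\infty$, and quasi-convex if the sets $\{\bar H\le\lambda\}$ are convex for all $\lambda\in\mathbb{R}$. *)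

(* Defs.v *)
From HB Require Import structures.
From mathcomp Require Import all_boot all_order all_algebra.
From mathcomp Require Import all_classical all_reals all_analysis.

Set Implicit Arguments.
Unset Strict Implicit.
Unset Printing Implicit Defensive.

Import Order.TTheory GRing.Theory Num.Theory.
Import numFieldNormedType.Exports.

Local Open Scope classical_set_scope.
Local Open Scope ring_scope.

(* A Hamiltonian is curried in the order time, space, gradient; functions on
   the space-time plane take a pair (t, x). *)

Section Defs.
Variable R : realType.

Implicit Types (H G : R -> R -> R -> R) (f : R -> R) (u : R * R -> R).

Inductive side : Set := Lside | Rside.

Definition nonincreasing_left_of (p0 : R) f :=
  forall p q, p <= q -> q < p0 -> f q <= f p.

Definition nondecreasing_right_of (p0 : R) f :=
  forall p q, p0 < p -> p <= q -> f p <= f q.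

(* Only the values on [0, +oo) matter. *)
Definition modulus_of_continuity (w : R -> R) :=
  [/\ w 0 = 0,
      forall r s, 0 <= r -> r <= s -> w r <= w s
    & w r @[r --> 0^'+] --> 0].

Definition ham_continuous H :=
  continuous (fun z : R * R * R => H z.1.1 z.1.2 z.2).

Definition time_periodic H :=
  forall (k : int) (t x p : R), H (t + k%:~R) x p = H t x p.

Definition time_regular H :=
  exists w : R -> R, modulus_of_continuity w /\
    forall t s x p : R,
      H t x p - H s x p <= w (`|t - s| * (1 + Num.max (H s x p) 0)).

Definition uniformly_coercive H :=
  forall M : R, exists K : R,
    forall q, K <= `|q| -> forall t x, M <= H t x q.

Definition monotone_outside H :=
  exists rho0 : R, 0 < rho0 /\
    forall x : R, ~ (- rho0 < x < rho0) ->
      exists p0 : R -> R, continuous p0 /\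
        forall t, nonincreasing_left_of (p0 t) (H t x) /\
                  nondecreasing_right_of (p0 t) (H t x).

Definition close_after_shift H G (k : int) (e : R) :=
  forall t x p : R, 0 <= t <= 1 -> 0 <= x <= 1 ->
    `|H t (x + k%:~R) p - G t x p| < e.

Definition asymptotically_periodic H (Ha : side -> R -> R -> R -> R) :=
  [/\ forall e : R, 0 < e -> exists K : int, forall k : int, k <= K ->
        close_after_shift H (Ha Lside) k e,
      forall e : R, 0 < e -> exists K : int, forall k : int, K <= k ->
        close_after_shift H (Ha Rside) k e
    & forall (a : side) (k j : int) (t x p : R),
        Ha a (t + k%:~R) (x + j%:~R) p = Ha a t x p].

Definition autonomous_quasiconvex G :=
  (forall t s x p : R, G t x p = G s x p) /\
  exists p0 : R, forall t x : R,
    nonincreasing_left_of p0 (G t x) /\ nondecreasing_right_of p0 (G t x).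

Definition convex_in_gradient G :=
  forall t x : R, convex_function (E := R^o) setT (G t x).

(* [nbhs z] is not punctured, so these are the semicontinuous envelopes; they
   are real-valued when [u] is locally bounded. *)
Definition usc_envelope u (z : R * R) : \bar R := limf_esup (EFin \o u) (nbhs z).
Definition lsc_envelope u (z : R * R) : \bar R := limf_einf (EFin \o u) (nbhs z).

Definition dt (phi : R * R -> R) (z : R * R) : R := 'D_((1, 0) : R * R) phi z.
Definition dx (phi : R * R -> R) (z : R * R) : R := 'D_((0, 1) : R * R) phi z.

Definition C1 (phi : R * R -> R) :=
  [/\ forall z, differentiable phi z, continuous (dt phi) & continuous (dx phi)].

Definition touches_above (phi : R * R -> R) (U : R * R -> \bar R) (z : R * R) :=
  U z = (phi z)%:E /\ \forall y \near z, (U y <= (phi y)%:E)%E.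

Definition touches_below (phi : R * R -> R) (U : R * R -> \bar R) (z : R * R) :=
  U z = (phi z)%:E /\ \forall y \near z, ((phi y)%:E <= U y)%E.

(* Viscosity sub- and super-solutions of u_t + G(t, x, u_x) = c on the plane. *)
Definition visc_subsolution G (c : R) u :=
  forall phi z, C1 phi -> touches_above phi (usc_envelope u) z ->
    dt phi z + G z.1 z.2 (dx phi z) <= c.

Definition visc_supersolution G (c : R) u :=
  forall phi z, C1 phi -> touches_below phi (lsc_envelope u) z ->
    c <= dt phi z + G z.1 z.2 (dx phi z).

Definition visc_solution G (c : R) u :=
  visc_subsolution G c u /\ visc_supersolution G c u.

Definition Z2_periodic u :=
  forall (k j : int) (t x : R), u (t + k%:~R, x + j%:~R) = u (t, x).

Definition bounded_plane u := exists M : R, forall z, `|u z| <= M.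

Definition ergodic_constant G (p lam : R) :=
  exists v : R * R -> R,
    [/\ bounded_plane v,
        visc_solution (fun t x q => G t x (p + q)) lam v
      & Z2_periodic v].

Definition coercive f :=
  f q @[q --> +oo] --> +oo /\ f q @[q --> -oo] --> +oo.

Definition quasi_convex f :=
  forall lam : R, convex_set (M := R^o) [set p | f p <= lam].

End Defs.

(* Main.v *)
Require Import Defs.
From HB Require Import structures.
From mathcomp Require Import all_boot all_order all_algebra.
From mathcomp Require Import all_classical all_reals all_analysis.
From mathcomp Require Import ring lra.
Import Order.TTheory GRing.Theory Num.Theory.
Import numFieldNormedType.Exports.
Local Open Scope classical_set_scope.
Local Open Scope ring_scope.

(* The equation with a discount, d v + v_t + H_a(t, x, p + v_x) = 0, has a
   possibly discontinuous solution by Perron's method.  Taking the supremum of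
   all sub-solutions makes it invariant under every translation that preserves
   the equation, hence periodic, and stationary when H_a is autonomous.
   Coercivity (linear growth in the convex case, stationarity in the autonomous
   one) makes it a sub-solution of v_t + b v_x <= K for all small b, and a
   periodic sub-solution of these transport equations has an oscillation bounded
   independently of d.  The comparison principle, proved by doubling variables
   with separate time and space penalisations, pins down the limit of the
   constants as d -> 0; monotone limits then give a bounded sub- and a bounded
   super-solution for the same constant, and Perron's method between the two
   gives the corrector.  Comparison also yields uniqueness and, applied to two
   sub-solutions with weights th and 1 - th, quasi-convexity; continuity follows
   from convexity, or from the gradient bound for stationary sub-solutions. *)

Set Implicit Arguments.
Unset Strict Implicit.
Unset Printing Implicit Defensive.

(** * Upper semicontinuous functions and envelopes *)

(** In the time-dependent case the equation bounds no gradient of a sub-solution, since [v_t] may be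
    very negative; solutions may jump and no equicontinuity is available. The order of the
    parameters compensates for this in the comparison: the time weight [n] is fixed first, with
    [n (s - t)^2] small. The equation bounds [H] by a constant plus [2 n |s - t|], so the error that
    (A2) allows in time is controlled by [|s - t|] and [n (s - t)^2]. Only then does coercivity
    bound the momentum, by a constant depending on [n], and the space weight [m] is sent to
    infinity. For the oscillation, speeds [|b| <= c] suffice because modulo the lattice they connect
    any two points within time [1/c + 1], so a bound on the increase along lines bounds the
    oscillation. For the limit of vanishing slack, the largest sub-solution within fixed bounds
    replaces any extracted subsequence: it is automatically monotone in the slack and invariant.
    Comparison uses three variables, one for each of two sub-solutions and one for the
    super-solution; taking the same sub-solution twice gives the ordinary principle. *)

Definition usc {R : realType} {T : topologicalType} (U : T -> R) :=
  forall z e, 0 < e -> \forall y \near z, U y < U z + e.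

Lemma usc_max {R : realType} {T : topologicalType} (U : T -> R) (K : set T) :
  usc U -> compact K -> K !=set0 ->
  exists2 z, K z & forall y, K y -> U y <= U z.
Proof.
move=> uU /compact_near_coveringP cK [z0 Kz0]; apply: contrapT => nomax.
have above z : K z -> exists2 y, K y & U z < U y.
  move=> Kz; apply: contrapT => h; apply: nomax; exists z => // y Ky.
  by rewrite leNgt; apply/negP => Uzy; apply: h; exists y.
(* [F] is the filter of levels approaching the supremum of [U] over [K] from below. Without a
   maximum, [U] is locally below such levels; compactness makes this uniform, which fails at the
   point defining the level. *)
pose F : set_system R := filter_from K (fun y => [set r | U y <= r]).
have FF : Filter F.
  apply: filter_from_filter; first by exists z0.
  move=> y1 y2 K1 K2.
  have [le12|le21] := leP (U y1) (U y2).
    by exists y2 => // r /= hr; split => //=; exact: le_trans hr.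
  by exists y1 => // r /= hr; split => //=; apply: le_trans hr; exact: ltW.
have [x Kx|y Ky hy] := cK _ F (fun i x => U x < i) FF.
  have [y Ky Uxy] := above x Kx.
  exists ([set x' | U x' < U y], [set r | U y <= r]) => /=.
    split; last by exists y.
    have := uU x (U y - U x); rewrite subr_gt0 => /(_ Uxy).
    by apply: filterS => x' /=; rewrite addrC subrK.
  by case=> x' r [/=]; exact: lt_le_trans.
by have /= := hy _ (lexx (U y)) y Ky; rewrite ltxx.
Qed.

Section Envelope.
Context {R : realType}.
Implicit Types (u : R * R -> R) (z : R * R).

Lemma near_normP z (P : set (R * R)) :
  (\forall y \near z, P y) <->
  exists2 r : R, 0 < r & forall y : R * R, `|y - z| < r -> P y.
Proof.
split=> [/nbhs_normP[r r0 h]|[r r0 h]].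
  by exists r => // y yz; apply: h; rewrite /= distrC.
by apply/nbhs_normP; exists r => //= y /=; rewrite distrC; exact: h.
Qed.

(** Real-valued form of the upper envelope, convenient for inequalities; for bounded [u] the lower
    envelope is the opposite of the [env] of the opposite function. *)
Definition env u z := inf [set c : R | \forall y \near z, u y <= c].

Section Bounded.
Variables (u : R * R -> R) (bu : bounded_plane u).

Lemma env_has_inf z : has_inf [set c : R | \forall y \near z, u y <= c].
Proof.
case: bu => M hM; split.
  exists M; apply/near_normP; exists 1 => // y _.
  exact: le_trans (ler_norm _) (hM y).
exists (- M) => c /= /nbhs_singleton /= hc; apply: le_trans hc.
by have := hM z; rewrite ler_norml => /andP[].
Qed.

Lemma env_ge z : u z <= env u z.
Proof.
by apply: lb_le_inf => [|c /= /nbhs_singleton//]; case: (env_has_inf z).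
Qed.

Lemma env_le z (c : R) : (\forall y \near z, u y <= c) -> env u z <= c.
Proof. by move=> h; apply: ge_inf => //; case: (env_has_inf z). Qed.

Lemma env_lt_near z (c : R) : env u z < c -> \forall y \near z, u y <= c.
Proof.
move=> h; have [d /= hd dc] := inf_lt (env_has_inf z).1 h.
by move: hd; apply: filterS => y yd; apply: le_trans yd (ltW dc).
Qed.

Lemma usc_env : usc (env u).
Proof.
move=> z e e0; have e20 : 0 < e / 2 by lra.
have /nbhs_interior : \forall y \near z, u y <= env u z + e / 2.
  by apply: env_lt_near; lra.
by apply: filterS => y /env_le; lra.
Qed.

Lemma env_approx z e (A : set (R * R)) : 0 < e -> (\forall y \near z, A y) ->
  exists2 y, A y & env u z - e < u y.
Proof.
move=> e0 hA; apply: contrapT => h.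
suff : env u z <= env u z - e by lra.
apply: env_le; move: hA; apply: filterS => y Ay; rewrite leNgt; apply/negP => H.
by apply: h; exists y.
Qed.

Lemma env_id : usc u -> env u = u.
Proof.
move=> uu; apply/funext => z; apply/eqP; rewrite eq_le env_ge andbT.
apply/ler_addgt0Pr => e e0; apply: env_le; have := uu z e e0.
by apply: filterS => y /ltW.
Qed.

Lemma usc_envelopeE z : usc_envelope u z = (env u z)%:E.
Proof.
rewrite /usc_envelope limf_esupE; apply/eqP; rewrite eq_le; apply/andP; split.
  apply/lee_addgt0Pr => e e0.
  have h : \forall y \near z, u y <= env u z + e by apply: env_lt_near; lra.
  apply: (@le_trans _ _ (ereal_sup ((EFin \o u) @` [set y | u y <= env u z + e]))).
    by apply: ereal_inf_lbound; exists [set y | u y <= env u z + e].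
  by apply: ge_ereal_sup => _ [y /= hy <-]; rewrite -EFinD lee_fin.
apply: le_ereal_inf_tmp => _ [V nV <-].
have bV y : V y -> ((u y)%:E <= ereal_sup ((EFin \o u) @` V))%E.
  by move=> Vy; apply: ereal_sup_ubound; exists y.
move: bV; case: (ereal_sup _) => [r||] bV; last 2 first.
- by rewrite leey.
- by have := bV _ (nbhs_singleton nV).
rewrite lee_fin; apply: env_le; move: nV; apply: filterS => y /bV.
by rewrite lee_fin.
Qed.

Lemma env_ub (b : R) : (forall z, u z <= b) -> forall z, env u z <= b.
Proof. by move=> h z; apply: env_le; apply/near_normP; exists 1. Qed.

Lemma env_lb (a : R) : (forall z, a <= u z) -> forall z, a <= env u z.
Proof. by move=> h z; apply: le_trans (h z) (env_ge z). Qed.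

Lemma bounded_env : bounded_plane (env u).
Proof.
case: bu => M hM; exists M => z; rewrite ler_norml; apply/andP; split.
  by apply: env_lb => y; have := hM y; rewrite ler_norml => /andP[].
by apply: env_ub => y; have := hM y; rewrite ler_norml => /andP[].
Qed.

Lemma bounded_planeN : bounded_plane (fun z => - u z).
Proof. by case: bu => M hM; exists M => z; rewrite normrN. Qed.

End Bounded.

Lemma lsc_envelopeE u z : bounded_plane u ->
  lsc_envelope u z = (- env (fun y => (- u y)%R) z)%:E.
Proof.
move=> bu; rewrite /lsc_envelope /limf_einf EFinN.
by rewrite -(usc_envelopeE (bounded_planeN bu)).
Qed.

Lemma env_le_mono u v z : bounded_plane u -> bounded_plane v ->
  (\forall y \near z, u y <= v y) -> env u z <= env v z.
Proof.
move=> bu bv uv; apply/ler_addgt0Pr => e e0; apply: env_le => //.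
have : \forall y \near z, v y <= env v z + e by apply: env_lt_near => //; lra.
by move: uv; apply: filterS2 => y; exact: le_trans.
Qed.

Lemma env_shift u (g z : R * R) : env (fun y => u (y + g)) z = env u (z + g).
Proof.
rewrite /env; congr (inf _); apply/seteqP; split => c /=.
  move=> /near_normP[r r0 h]; apply/near_normP; exists r => // y yz.
  by have := h (y - g); rewrite subrK; apply; rewrite -addrA -opprD [g + z]addrC.
move=> /near_normP[r r0 h]; apply/near_normP; exists r => // y yz.
by apply: h; rewrite opprD addrACA subrr addr0.
Qed.

End Envelope.

(** * Test functions *)

Section Calculus.
Context {R : realType}.
Implicit Types (f g a b : R * R -> R) (z : R * R).

(** Carries the partial derivatives explicitly, so that test functions are assembled algebraically
    and never differentiated by hand. *)
Definition has_grad f a b :=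
  [/\ forall z, differentiable f z, forall z, dt f z = a z,
      forall z, dx f z = b z, continuous a & continuous b].

Lemma has_grad_C1 f : C1 f <-> has_grad f (dt f) (dx f).
Proof. by split=> [[df ca cb]|[df _ _ ca cb]]. Qed.

Lemma C1_has_grad f a b : has_grad f a b ->
  [/\ C1 f, forall z, dt f z = a z & forall z, dx f z = b z].
Proof.
move=> [df ta xb ca cb]; split => //; split => //.
- by move/funext: ta => ->.
- by move/funext: xb => ->.
Qed.

Lemma has_grad_cst (c : R) : has_grad (fun=> c) (fun=> 0) (fun=> 0).
Proof.
split=> [z|z|z||]; rewrite /dt /dx ?derive_cst//.
- by move=> z; exact: cvg_cst.
- by move=> z; exact: cvg_cst.
Qed.

Lemma has_gradD f a b g a' b' : has_grad f a b -> has_grad g a' b' ->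
  has_grad (fun z => f z + g z) (fun z => a z + a' z) (fun z => b z + b' z).
Proof.
move=> [df fa fb ca cb] [dg ga gb ca' cb']; split=> [z|z|z|z|z].
- exact: differentiableD.
- by rewrite -fa -ga /dt deriveD//; exact: diff_derivable.
- by rewrite -fb -gb /dx deriveD//; exact: diff_derivable.
- by apply: cvgD; [exact: ca|exact: ca'].
- by apply: cvgD; [exact: cb|exact: cb'].
Qed.

Lemma has_gradZ f a b (c : R) : has_grad f a b ->
  has_grad (fun z => c * f z) (fun z => c * a z) (fun z => c * b z).
Proof.
move=> [df fa fb ca cb]; split=> [z|z|z|z|z].
- exact: differentiableZ.
- by rewrite -fa /dt deriveZ//; exact: diff_derivable.
- by rewrite -fb /dx deriveZ//; exact: diff_derivable.
- by apply: cvgMr; exact: ca.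
- by apply: cvgMr; exact: cb.
Qed.

Lemma has_gradN f a b : has_grad f a b ->
  has_grad (fun z => - f z) (fun z => - a z) (fun z => - b z).
Proof.
move=> [df fa fb ca cb]; split=> [z|z|z|z|z].
- exact: differentiableN.
- by rewrite -fa /dt deriveN//; exact: diff_derivable.
- by rewrite -fb /dx deriveN//; exact: diff_derivable.
- by apply: cvgN; exact: ca.
- by apply: cvgN; exact: cb.
Qed.

Lemma has_gradM f a b g a' b' : has_grad f a b -> has_grad g a' b' ->
  has_grad (fun z => f z * g z) (fun z => f z * a' z + g z * a z)
    (fun z => f z * b' z + g z * b z).
Proof.
move=> [df fa fb ca cb] [dg ga gb ca' cb'].
have cf : continuous f by move=> z; exact: differentiable_continuous.
have cg : continuous g by move=> z; exact: differentiable_continuous.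
split=> [z|z|z|z|z].
- exact: differentiableM.
- by rewrite -fa -ga /dt deriveM//; exact: diff_derivable.
- by rewrite -fb -gb /dx deriveM//; exact: diff_derivable.
- by apply: cvgD; apply: cvgM; [exact: cf|exact: ca'|exact: cg|exact: ca].
- by apply: cvgD; apply: cvgM; [exact: cf|exact: cb'|exact: cg|exact: cb].
Qed.

Lemma differentiable_fst z : differentiable (fst : R * R -> R) z.
Proof. by apply: linear_differentiable; move=> y; exact: cvg_fst. Qed.

Lemma differentiable_snd z : differentiable (snd : R * R -> R) z.
Proof. by apply: linear_differentiable; move=> y; exact: cvg_snd. Qed.

Lemma derive_fst z v : 'D_v (fst : R * R -> R) z = v.1.
Proof.
rewrite deriveE; last exact: differentiable_fst.
by rewrite diff_lin// => y; exact: cvg_fst.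
Qed.

Lemma derive_snd z v : 'D_v (snd : R * R -> R) z = v.2.
Proof.
rewrite deriveE; last exact: differentiable_snd.
by rewrite diff_lin// => y; exact: cvg_snd.
Qed.

Lemma has_grad_fst : has_grad fst (fun=> 1) (fun=> 0).
Proof.
split=> [z|z|z||]; rewrite /dt /dx ?derive_fst//.
- exact: differentiable_fst.
- by move=> z; exact: cvg_cst.
- by move=> z; exact: cvg_cst.
Qed.

Lemma has_grad_snd : has_grad snd (fun=> 0) (fun=> 1).
Proof.
split=> [z|z|z||]; rewrite /dt /dx ?derive_snd//.
- exact: differentiable_snd.
- by move=> z; exact: cvg_cst.
- by move=> z; exact: cvg_cst.
Qed.

Lemma has_grad_eq f a b f' a' b' : has_grad f a b ->
  f =1 f' -> a =1 a' -> b =1 b' -> has_grad f' a' b'.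
Proof. by move=> h /funext <- /funext <- /funext <-. Qed.

Lemma has_grad_affine (al be c : R) :
  has_grad (fun z => al * z.1 + be * z.2 + c) (fun=> al) (fun=> be).
Proof.
have h := has_gradD (has_gradD (has_gradZ al has_grad_fst)
  (has_gradZ be has_grad_snd)) (has_grad_cst c).
by apply: (has_grad_eq h) => z; rewrite ?mulr1 ?mulr0 ?addr0 ?add0r.
Qed.

Lemma has_grad_sq (al be c : R) :
  has_grad (fun z => (al * z.1 + be * z.2 + c) ^+ 2)
    (fun z => 2 * al * (al * z.1 + be * z.2 + c))
    (fun z => 2 * be * (al * z.1 + be * z.2 + c)).
Proof.
have h := has_gradM (has_grad_affine al be c) (has_grad_affine al be c).
by apply: (has_grad_eq h) => z; rewrite ?expr2//; ring.
Qed.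

Lemma has_grad_shift f a b (s : R * R) : has_grad f a b ->
  has_grad (fun z => f (z + s)) (fun z => a (z + s)) (fun z => b (z + s)).
Proof.
move=> [df fa fb ca cb].
have cs z : (fun y : R * R => y + s) @ z --> z + s.
  by apply: cvgD; [exact: cvg_id|exact: cvg_cst].
have Dshift v z : 'D_v (fun y => f (y + s)) z = 'D_v f (z + s).
  rewrite /derive (_ : (fun y => f (y + s)) \o shift z = f \o shift (z + s))//.
  by apply/funext => y; rewrite /= addrA.
split=> [z|z|z|z|z].
- exact: (@differentiable_comp _ _ _ _ (fun y : R * R => y + s) f).
- by rewrite /dt Dshift -fa.
- by rewrite /dx Dshift -fb.
- by apply: cvg_comp (cs z) _; exact: ca.
- by apply: cvg_comp (cs z) _; exact: cb.
Qed.

(** Only the ray matters: this serves functions that are known to be invariant in one direction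
    only. *)
Lemma derive_ge0_along f z v : differentiable f z ->
  (\forall k \near (0 : R)^'+, f z <= f (k *: v + z)) -> 0 <= 'D_v f z.
Proof.
move=> df fz.
have h : h^-1 *: (f (h *: v + z) - f z) @[h --> (0 : R)^'+] --> 'D_v f z.
  by apply: cvg_dnbhs_at_right; exact: (diff_derivable df).
apply: (cvgr_to_ge h).
near=> k; have k0 : 0 < k by near: k; exact: nbhs_right_gt.
apply: mulr_ge0; first by rewrite invr_ge0 ltW.
by rewrite subr_ge0; near: k.
Unshelve. all: by end_near. Qed.

Lemma near_along z v (P : R * R -> Prop) : (\forall y \near z, P y) ->
  \forall k \near (0 : R)^'+, P (k *: v + z).
Proof.
move=> /near_normP[r r0 hr]; near=> k.
have k0 : 0 < k by near: k; exact: nbhs_right_gt.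
apply: hr; rewrite addrK normrZ gtr0_norm//.
have v0 : 0 < `|v| + 1 by rewrite ltr_pwDr.
apply: (@le_lt_trans _ _ (k * (`|v| + 1))); first by rewrite ler_pM2l// lerDl.
by rewrite -ltr_pdivlMr//; near: k; apply: nbhs_right_lt; exact: divr_gt0.
Unshelve. all: by end_near. Qed.

Lemma derive_ge0_at_min f z v : differentiable f z -> f z = 0 ->
  (\forall y \near z, 0 <= f y) -> 0 <= 'D_v f z.
Proof.
move=> df fz0 fge; apply: derive_ge0_along; rewrite ?fz0//.
exact: (near_along v fge).
Qed.

Lemma derive_eq0_at_min f z v : differentiable f z -> f z = 0 ->
  (\forall y \near z, 0 <= f y) -> 'D_v f z = 0.
Proof.
move=> df fz0 fge; apply/eqP; rewrite eq_le derive_ge0_at_min// andbT.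
have := derive_ge0_at_min (- v) df fz0 fge.
by rewrite !deriveE// linearN oppr_ge0.
Qed.

Lemma grad_eq_at_touch f g z : C1 f -> C1 g -> f z = g z ->
  (\forall y \near z, f y <= g y) -> dt f z = dt g z /\ dx f z = dx g z.
Proof.
move=> [df _ _] [dg _ _] fg le_fg.
have h v : 'D_v f z = 'D_v g z.
  apply/eqP; rewrite eq_sym -subr_eq0 -deriveB; try exact: diff_derivable.
  apply/eqP; apply: derive_eq0_at_min; first exact: differentiableB.
    by rewrite /= !fctE fg subrr.
  by move: le_fg; apply: filterS => y; rewrite !fctE subr_ge0.
by split; rewrite /dt /dx h.
Qed.

End Calculus.

(** * Stability of sub-solutions *)

Section Stability.
Context {R : realType}.
Implicit Types (phi u v : R * R -> R) (z : R * R)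
  (F : R * R -> R -> R -> R -> R).

Lemma norm_pair_le z (r : R) : (`|z| <= r) = (`|z.1| <= r) && (`|z.2| <= r).
Proof. by rewrite /Num.norm /= ge_max. Qed.

Lemma norm_pair_lt z (r : R) : (`|z| < r) = (`|z.1| < r) && (`|z.2| < r).
Proof. by rewrite /Num.norm /= gt_max. Qed.

Lemma compact_cball z (r : R) : compact [set y | `|y - z| <= r].
Proof.
have -> : [set y | `|y - z| <= r] =
    `[z.1 - r, z.1 + r]%classic `*` `[z.2 - r, z.2 + r]%classic.
  apply/seteqP; split => y; rewrite /= !in_itv /= norm_pair_le !ler_norml /=.
    by move=> /andP[/andP[? ?] /andP[? ?]]; split; apply/andP; split; lra.
  by move=> [/andP[? ?] /andP[? ?]]; apply/andP; split; apply/andP; split; lra.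
by apply: compact_setX; exact: segment_compact.
Qed.

(** No envelope is taken here: a discontinuous [u] enters as [env u], and a super-solution as a
    sub-solution for the reflected operator. The value argument of [F] accommodates the discount. *)
Definition vsub F u := forall phi z, C1 phi -> u z = phi z ->
  (\forall y \near z, u y <= phi y) -> F z (phi z) (dt phi z) (dx phi z) <= 0.

Definition vcont F := forall z r a q e, 0 < e ->
  exists2 d : R, 0 < d & forall (z' : R * R) (r' a' q' : R),
    `|z' - z| < d -> `|r' - r| < d -> `|a' - a| < d -> `|q' - q| < d ->
    `|F z' r' a' q' - F z r a q| < e.

Lemma C1_continuous phi : C1 phi -> continuous phi.
Proof. by move=> [d _ _] z; exact: differentiable_continuous. Qed.

Lemma continuous_near phi z (e : R) : continuous phi -> 0 < e ->
  \forall y \near z, `|phi y - phi z| < e.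
Proof.
move=> cphi e0; have /cvgrPdist_lt := cphi z; move=> /(_ e e0).
by apply: filterS => y; rewrite distrC.
Qed.

Lemma vcont_near F phi z (e : R) : vcont F -> C1 phi -> 0 < e ->
  exists2 d : R, 0 < d & forall (y : R * R) (m : R), `|y - z| < d -> `|m| < d ->
   `|F y (phi y + m) (dt phi y) (dx phi y)
     - F z (phi z) (dt phi z) (dx phi z)| < e.
Proof.
move=> cF cphi e0; have [d d0 hd] := cF z (phi z) (dt phi z) (dx phi z) e e0.
have d20 : 0 < d / 2 by lra.
have c0 := C1_continuous cphi; case: (cphi) => _ c1 c2.
have /near_normP[r r0 hr] : \forall y \near z,
    [/\ `|phi y - phi z| < d / 2, `|dt phi y - dt phi z| < d
      & `|dx phi y - dx phi z| < d].
  have n0 := @continuous_near phi z _ c0 d20.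
  have n1 := @continuous_near (dt phi) z _ c1 d0.
  have n2 := @continuous_near (dx phi) z _ c2 d0.
  by move: n0 n1 n2; apply: filterS3 => y n0 n1 n2; split.
exists (Num.min (Num.min r d) (d / 2)); first by rewrite !lt_min r0 d0 d20.
move=> y m; rewrite !lt_min => /andP[/andP[yr yd] _] /andP[_ md].
have [h0 h1 h2] := hr y yr.
apply: (hd _ _ _ _ yd _ h1 h2).
rewrite addrAC [d]splitr; apply: (le_lt_trans (ler_normD _ _)).
exact: ltrD.
Qed.

(* The slack k lets this apply to suprema, where contact is only approximate,
   and to decreasing limits, where the equation is also perturbed. *)
Lemma no_interior_max F phi z0 : vcont F -> C1 phi ->
  0 < F z0 (phi z0) (dt phi z0) (dx phi z0) ->
  exists2 k : R, 0 < k & forall (rho kap : R) u, 0 < rho -> rho <= k -> kap <= k ->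
    usc u -> vsub (fun z r a q => F z r a q - k) u ->
    (forall z : R * R, rho <= `|z - z0| -> `|z - z0| <= 2 * rho ->
       u z < phi z - kap) ->
    (exists2 z : R * R, `|z - z0| < rho & phi z - kap <= u z) ->
    (forall z : R * R, `|z - z0| <= 2 * rho -> u z <= phi z + kap) -> False.
Proof.
move=> cF cphi F0; set f0 := F _ _ _ _ in F0.
have [d d0 hd] := @vcont_near F phi z0 (f0 / 2) cF cphi ltac:(lra).
(* [d / 4] keeps the maximum point and the height [w z2] where [F] exceeds [f0 / 2]; the slack, at
   most [f0 / 4], cannot compensate for this. *)
exists (Num.min (d / 4) (f0 / 4)); first by rewrite lt_min; apply/andP; split; lra.
move=> rho kap u rho0; rewrite !le_min => /andP[rd _] /andP[kd kf] uu su ann.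
move=> [z1 z1r z1k] uk.
pose w y := u y - phi y.
have uw : usc w.
  move=> z e e0; have e20 : 0 < e / 2 by lra.
  near=> y; rewrite /w.
  have h1 : u y < u z + e / 2 by near: y; exact: uu.
  have : `|phi y - phi z| < e / 2.
    by near: y; apply: continuous_near => //; exact: C1_continuous.
  by rewrite ltr_norml => /andP[h2 h3]; lra.
have [|z2 /= z2r z2max] := usc_max uw (@compact_cball z0 (2 * rho)).
  by exists z0 => /=; rewrite subrr normr0; lra.
have wz1 : - kap <= w z1 by rewrite /w; lra.
have z12 : w z1 <= w z2 by apply: z2max => /=; lra.
have z2rho : `|z2 - z0| < rho.
  rewrite ltNge; apply/negP => h; have := ann _ h z2r.
  by move: wz1 z12; rewrite /w; lra.
have wz2 : w z2 <= kap by have := uk _ z2r; rewrite /w; lra.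
have hg := has_gradD ((has_grad_C1 phi).1 cphi) (has_grad_cst (w z2)).
have [cpsi tpsi xpsi] := C1_has_grad hg.
have := su _ z2 cpsi; rewrite tpsi xpsi !addr0 => h.
have : F z2 (phi z2 + w z2) (dt phi z2) (dx phi z2)
    - Num.min (d / 4) (f0 / 4) <= 0.
  apply: h; first by rewrite /w; lra.
  apply/near_normP; exists (rho - `|z2 - z0|); first lra.
  move=> y yz2; have : w y <= w z2.
    apply: z2max => /=.
    have -> : y - z0 = (y - z2) + (z2 - z0) by rewrite addrA subrK.
    by apply: (le_trans (ler_normD _ _)); lra.
  by rewrite /w; lra.
have hm : Num.min (d / 4) (f0 / 4) <= f0 / 4 by rewrite ge_min lexx orbT.
have := hd z2 (w z2) ltac:(lra) ltac:(by rewrite ltr_norml; apply/andP; split; lra).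
by rewrite ltr_norml -/f0 => /andP[? ?]; lra.
Unshelve. all: by end_near. Qed.


Definition paraboloid z0 (y : R * R) : R :=
  (1 * y.1 + 0 * y.2 + - z0.1) ^+ 2 + (0 * y.1 + 1 * y.2 + - z0.2) ^+ 2.

Lemma paraboloid_ge z0 y (r : R) : 0 <= r -> r <= `|y - z0| ->
  r ^+ 2 <= paraboloid z0 y.
Proof.
move=> r0; rewrite leNgt norm_pair_lt negb_and -!leNgt /= => h.
rewrite /paraboloid !mul1r !mul0r addr0 add0r.
by case/orP: h => h; [apply: ler_wpDr|apply: ler_wpDl];
  rewrite ?sqr_ge0// -[leRHS]real_normK ?num_real// lerXn2r// nnegrE.
Qed.

Lemma has_grad_paraboloid z0 : has_grad (paraboloid z0)
  (fun y => 2 * (y.1 - z0.1)) (fun y => 2 * (y.2 - z0.2)).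
Proof.
apply: (has_grad_eq (has_gradD (has_grad_sq 1 0 (- z0.1))
  (has_grad_sq 0 1 (- z0.2)))) => y //=; ring.
Qed.

Lemma paraboloid_center z0 : paraboloid z0 z0 = 0.
Proof. by rewrite /paraboloid; ring. Qed.

Definition add_paraboloid phi z0 y := phi y + paraboloid z0 y.

(* Adding a paraboloid makes the contact strict without changing the
   gradient. *)
Lemma C1_add_paraboloid phi z0 : C1 phi ->
  [/\ C1 (add_paraboloid phi z0), add_paraboloid phi z0 z0 = phi z0,
    dt (add_paraboloid phi z0) z0 = dt phi z0
  & dx (add_paraboloid phi z0) z0 = dx phi z0].
Proof.
move=> cphi.
have [cpsi tpsi xpsi] := C1_has_grad (has_gradD ((has_grad_C1 phi).1 cphi)
  (has_grad_paraboloid z0)).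
split; first exact: cpsi.
- by rewrite /add_paraboloid paraboloid_center addr0.
- by rewrite [LHS]tpsi subrr mulr0 addr0.
- by rewrite [LHS]xpsi subrr mulr0 addr0.
Qed.

Definition vsup (S : set (R * R -> R)) z : R := sup [set u z | u in S].

Lemma vsup_ge S u z (M : R) : (forall u, S u -> u z <= M) -> S u ->
  u z <= vsup S z.
Proof.
move=> hM Su; apply: ub_le_sup; last by exists u.
by exists M => _ [v Sv <-]; exact: hM.
Qed.

Lemma vsup_le S z (M : R) : S !=set0 -> (forall u, S u -> u z <= M) ->
  vsup S z <= M.
Proof.
move=> [u Su] hM; apply: ge_sup; first by exists (u z), u.
by move=> _ [v Sv <-]; exact: hM.
Qed.

Lemma vsup_gt S z (c : R) : S !=set0 -> c < vsup S z -> exists2 u, S u & c < u z.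
Proof.
move=> [u Su] /sup_gt -[|_ [v Sv <-]]; first by exists (u z), u.
by exists v.
Qed.

Lemma bounded_vsup S (M : R) : S !=set0 -> (forall u z, S u -> `|u z| <= M) ->
  bounded_plane (vsup S).
Proof.
move=> S0 hM; exists M => z; have [u Su] := S0.
have hM' v : S v -> - M <= v z <= M by move=> Sv; rewrite -ler_norml; exact: hM.
rewrite ler_norml vsup_le// ?andbT; last by move=> v /hM' /andP[].
apply: le_trans (vsup_ge (M := M) _ Su); first by have /andP[] := hM' u Su.
by move=> v /hM' /andP[].
Qed.

End Stability.

(** * Suprema and decreasing limits of sub-solutions *)

Section StableLimits.
Context {R : realType}.
Implicit Types (phi u v : R * R -> R) (z : R * R)
  (F : R * R -> R -> R -> R -> R).

(** At a strict contact of the envelope of the supremum, a single member of [S] almost reaches the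
    test function nearby, and so has an interior maximum relative to it. *)
Lemma vsub_vsup F S (M : R) : vcont F -> S !=set0 ->
  (forall u z, S u -> `|u z| <= M) -> (forall u, S u -> vsub F (env u)) ->
  vsub F (env (vsup S)).
Proof.
move=> cF S0 hM hS phi z0 cphi tz /near_normP[r r0 hr].
have hM1 u z : S u -> u z <= M by move=> /(hM u z); rewrite ler_norml => /andP[].
have bV := bounded_vsup S0 hM.
have bS u : S u -> bounded_plane u by move=> Su; exists M => z; exact: hM.
rewrite leNgt; apply/negP => F0.
have [] := C1_add_paraboloid z0 cphi.
set psi := add_paraboloid phi z0 => cpsi psiz pt px.
rewrite -psiz -pt -px in F0.
have [k k0 hk] := no_interior_max cF cpsi F0.
pose rho := Num.min k (r / 4).
have rho0 : 0 < rho by rewrite lt_min k0 divr_gt0.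
have rhor : rho <= r / 4 by rewrite ge_min lexx orbT.
(* On the ring the paraboloid is at least [rho ^ 2 > kap], which keeps every member strictly below
   [psi - kap] there. The member found below loses at most [kap] near the contact: a quarter for the
   envelope, a quarter for the supremum, half for the variation of [psi]. *)
pose kap := Num.min k (rho ^+ 2 / 2).
have kap0 : 0 < kap by rewrite lt_min k0 divr_gt0// exprn_gt0.
have kaprho : kap <= rho ^+ 2 / 2 by rewrite ge_min lexx orbT.
have kap20 : 0 < kap / 2 by rewrite divr_gt0.
have kap40 : 0 < kap / 4 by rewrite divr_gt0.
have near1 : \forall y \near z0, `|y - z0| < rho /\ `|psi y - psi z0| < kap / 2.
  have : \forall y \near z0, `|y - z0| < rho by apply/near_normP; exists rho.
  have := continuous_near z0 (C1_continuous cpsi) kap20.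
  by apply: filterS2.
have [y [yr ypsi] yV] := env_approx bV kap40 near1.
have : env (vsup S) z0 - kap / 4 - kap / 4 < vsup S y.
  by apply: lt_trans yV; rewrite ltrBlDr ltrDl.
move=> /(vsup_gt S0)[u Su uy].
have uV z : env u z <= env (vsup S) z.
  apply: env_le_mono; rewrite //; first exact: bS.
  by apply/near_normP; exists 1 => // z' _; apply: vsup_ge Su => v; exact: hM1.
have rho2 : 0 < rho ^+ 2 by rewrite exprn_gt0.
apply: (hk rho kap (env u)) => //.
- by rewrite ge_min lexx.
- by rewrite ge_min lexx.
- exact/usc_env/bS.
- move=> f z cf e1 e2; rewrite subr_le0; apply: le_trans (ltW k0).
  exact: (hS u Su).
- move=> z rz zr; apply: (le_lt_trans (uV z)).
  have := hr z ltac:(lra); have := paraboloid_ge (ltW rho0) rz.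
  by rewrite /psi /add_paraboloid; lra.
- exists y => //; apply: le_trans (env_ge (bS u Su) y).
  by move: ypsi; rewrite ltr_norml => /andP[_ ?]; lra.
- move=> z zr; apply: (le_trans (uV z)); have := hr z ltac:(lra).
  have : 0 <= paraboloid z0 z by rewrite addr_ge0 ?sqr_ge0.
  by rewrite /psi /add_paraboloid; lra.
Qed.

(** Dini's argument: a decreasing family of upper semi-continuous functions whose limit is below a
    continuous function gets below it, up to any margin, uniformly on compact sets. *)
Lemma vsub_decreasing_limit F (W : R -> R * R -> R) u : vcont F ->
  (forall e, 0 < e -> usc (W e)) ->
  (forall e, 0 < e -> vsub (fun z r a q => F z r a q - e) (W e)) ->
  (forall d e z, 0 < d -> d <= e -> W d z <= W e z) ->
  (forall e z, 0 < e -> u z <= W e z) ->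
  (forall z c, u z < c -> exists2 e, 0 < e & W e z < c) ->
  vsub F u.
Proof.
move=> cF uW sW mW uleW limW phi z0 cphi tz /near_normP[r r0 hr].
rewrite leNgt; apply/negP => F0.
have [] := C1_add_paraboloid z0 cphi.
set psi := add_paraboloid phi z0 => cpsi psiz pt px.
rewrite -psiz -pt -px in F0.
have [k k0 hk] := no_interior_max cF cpsi F0.
pose rho := Num.min k (r / 4).
have rho0 : 0 < rho by rewrite lt_min k0 divr_gt0.
have rhok : rho <= k by rewrite ge_min lexx.
have rhor : rho <= r / 4 by rewrite ge_min lexx orbT.
have rho2 : 0 < rho ^+ 2 by rewrite exprn_gt0.
pose kap := Num.min k (rho ^+ 2 / 2).
have kap0 : 0 < kap by rewrite lt_min k0 divr_gt0.
have kapk : kap <= k by rewrite ge_min lexx.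
have kaprho : kap <= rho ^+ 2 / 2 by rewrite ge_min lexx orbT.
have dini z c : u z < psi z + c ->
    exists2 e, 0 < e & \forall y \near z, W e y < psi y + c.
  move=> /limW[e e0 We]; exists e => //.
  pose gap := (psi z + c - W e z) / 2.
  have gap0 : 0 < gap by rewrite divr_gt0// subr_gt0.
  have n1 := continuous_near z (C1_continuous cpsi) gap0.
  have n2 := uW e e0 z gap gap0.
  move: n1 n2; apply: filterS2 => y; rewrite ltr_norml => /andP[n1 _] n2.
  by rewrite /gap in n1 n2; lra.
(* The two bounds that [no_interior_max] requires of [W e]. Each holds near a given point for one
   [e], hence for all smaller ones by monotonicity; compactness then gives a common [e]. *)
pose P e y := (W e y < psi y + kap) /\
  (rho <= `|y - z0| -> W e y < psi y - kap).
have upsi z : `|z - z0| <= 2 * rho -> u z <= psi z - paraboloid z0 z.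
  by move=> zr; rewrite /psi /add_paraboloid addrK; apply: hr; lra.
have covering z : `|z - z0| <= 2 * rho ->
    \forall y \near z & e \near 0^'+, P e y.
  move=> zr.
  have [e1 e10 n1] : exists2 e, 0 < e & \forall y \near z, W e y < psi y + kap.
    apply: dini; apply: (le_lt_trans (upsi z zr)).
    have : 0 <= paraboloid z0 z by rewrite addr_ge0 ?sqr_ge0.
    by lra.
  have [e2 e20 n2] : exists2 e, 0 < e & \forall y \near z,
      rho <= `|y - z0| -> W e y < psi y - kap.
    have [zrho|zrho] := ltP `|z - z0| rho.
      exists 1 => //; apply/near_normP; exists (rho - `|z - z0|).
        by rewrite subr_gt0.
      move=> y yz; rewrite leNgt => /negP[].
      rewrite -(subrK z y) -addrA; apply: (le_lt_trans (ler_normD _ _)).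
      by rewrite -ltrBrDr.
    have [e e0 n] : exists2 e, 0 < e & \forall y \near z, W e y < psi y + - kap.
      apply: dini; apply: (le_lt_trans (upsi z zr)).
      by have := paraboloid_ge (ltW rho0) zrho; lra.
    by exists e => //; move: n; apply: filterS.
  exists ([set y | W e1 y < psi y + kap /\
      (rho <= `|y - z0| -> W e2 y < psi y - kap)],
      [set e | 0 < e <= Num.min e1 e2]) => /=.
    split; first by move: n1 n2; apply: filterS2.
    near=> e; apply/andP; split; first by near: e; exact: nbhs_right_gt.
    by near: e; apply: nbhs_right_le; rewrite lt_min e10.
  move=> [y e] /= [[h1 h2] /andP[e0]]; rewrite le_min => /andP[ee1 ee2].
  split=> [|yr]; first exact: le_lt_trans (mW _ _ y e0 ee1) h1.
  exact: le_lt_trans (mW _ _ y e0 ee2) (h2 yr).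
have nearP : \forall e \near 0^'+, forall y, `|y - z0| <= 2 * rho -> P e y.
  have /compact_near_coveringP cK := @compact_cball R z0 (2 * rho).
  exact: (cK R (0^'+) P _ covering).
have [e [he e0 ek]] : exists e, [/\ forall y, `|y - z0| <= 2 * rho -> P e y,
    0 < e & e <= k].
  have nk : \forall e \near (0 : R)^'+, e <= k by apply: nbhs_right_le.
  have n0 : \forall e \near (0 : R)^'+, 0 < e by apply: nbhs_right_gt.
  have nn : \forall e \near (0 : R)^'+,
      [/\ forall y, `|y - z0| <= 2 * rho -> P e y, 0 < e & e <= k].
    by move: nearP n0 nk; apply: filterS3 => e; split.
  by have [e [h1 h2 h3]] :=
    @filter_ex _ _ (at_right_proper_filter (0 : R)) _ nn; exists e.
apply: (hk rho kap (W e)) => //.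
- exact: uW.
- move=> f z cf e1 e2; apply: le_trans (sW e e0 f z cf e1 e2).
  by rewrite lerD2l lerN2.
- by move=> z rz zr; exact: (he z zr).2.
- exists z0; first by rewrite subrr normr0.
  by rewrite psiz -tz lerBlDr; apply: (le_trans (uleW e z0 e0)); rewrite lerDl ltW.
- by move=> z zr; exact: ltW (he z zr).1.
Unshelve. all: by end_near. Qed.

End StableLimits.

(** * Perron's method *)

Section Perron.
Context {R : realType}.
Implicit Types (phi u v : R * R -> R) (z : R * R)
  (F : R * R -> R -> R -> R -> R).

(* u is a super-solution of F if and only if - u is a sub-solution of vneg F. *)
Definition vneg F z (r a q : R) : R := - F z (- r) (- a) (- q).

Lemma vcont_neg F : vcont F -> vcont (vneg F).
Proof.
move=> cF z r a q e e0; have [d d0 hd] := cF z (- r) (- a) (- q) e e0.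
exists d => // z' r' a' q' hz hr ha hq.
rewrite /vneg -opprD normrN; apply: hd => //.
- by rewrite -opprD normrN.
- by rewrite -opprD normrN.
- by rewrite -opprD normrN.
Qed.

(** The barriers bound [u] itself while the equation is tested on [env u], which may exceed a
    discontinuous [w0]. *)
Definition perron_class F u0 w0 : set (R * R -> R) :=
  [set u | (forall z, u0 z <= u z <= w0 z) /\ vsub F (env u)].

Section Solution.
Variables (F : R * R -> R -> R -> R -> R) (u0 w0 : R * R -> R) (M : R).
Hypotheses (cF : vcont F) (u0M : forall z, `|u0 z| <= M)
  (w0M : forall z, `|w0 z| <= M) (u0w0 : forall z, u0 z <= w0 z)
  (su0 : vsub F (env u0)) (sw0 : vsub (vneg F) (env (fun z => - w0 z))).

Let S := perron_class F u0 w0.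
Let V := vsup S.

Let Su0 : S u0. Proof. by split=> // z; rewrite lexx u0w0. Qed.

Let SM u z : S u -> `|u z| <= M.
Proof.
move=> [/(_ z)/andP[h1 h2] _]; have := u0M z; have := w0M z.
by rewrite !ler_norml => /andP[_ h3] /andP[h4 _]; apply/andP; split; lra.
Qed.

Lemma perron_between z : u0 z <= V z <= w0 z.
Proof.
apply/andP; split.
  apply: (vsup_ge (M := M)) => // u Su.
  by have := SM z Su; rewrite ler_norml => /andP[].
by apply: vsup_le; [exists u0|move=> u [/(_ z)/andP[]]].
Qed.

Lemma bounded_perron : bounded_plane V.
Proof. by apply: (@bounded_vsup _ S M); [exists u0|move=> u z; exact: SM]. Qed.

Lemma perron_sub : vsub F (env V).
Proof.
apply: (@vsub_vsup _ F S M) => //; first by exists u0.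
by move=> u [].
Qed.

Section Bump.
Variables (chi : R * R -> R) (z0 : R * R) (rho r kap : R).
Hypotheses (cchi : C1 chi) (rho0 : 0 < rho) (rhor : rho < r)
  (Fchi : forall z, `|z - z0| < r ->
     F z (chi z + kap) (dt chi z) (dx chi z) <= 0)
  (chiw0 : forall z, `|z - z0| < r -> chi z + kap <= w0 z)
  (chiV : forall z, rho <= `|z - z0| -> `|z - z0| < r -> chi z + kap <= V z).

Let w z := if `|z - z0| < r then Num.max (V z) (chi z + kap) else V z.

Let Vw z : V z <= w z.
Proof. by rewrite /w; case: ifP => // _; rewrite le_max lexx. Qed.

Let ww0 z : w z <= w0 z.
Proof.
have /andP[_ Vw0] := perron_between z.
by rewrite /w; case: ifP => // zr; rewrite ge_max Vw0 chiw0.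
Qed.

Let bw : bounded_plane w.
Proof.
exists M => z; have := u0M z; have := w0M z; have := Vw z; have := ww0 z.
have /andP[] := perron_between z.
rewrite !ler_norml => ? ? ? ? /andP[_ ?] /andP[? _].
by apply/andP; split; lra.
Qed.

Let chi_cont : continuous (fun z => chi z + kap).
Proof. by move=> z; apply: cvgD; [exact: C1_continuous|exact: cvg_cst]. Qed.

(** The envelope of a maximum with a continuous function is the maximum of the envelopes, so at each
    point a single one of two known sub-solutions has to be tested. *)
Let bump_cases z : env w z = env V z \/
  `|z - z0| < r /\ env w z = chi z + kap.
Proof.
have bV := bounded_perron.
have [le_wV|lt_Vw] := leP (env w z) (env V z).
  left; apply/eqP; rewrite eq_le le_wV/=; apply: env_le_mono => //.
  by apply/near_normP; exists 1.
have zrho : `|z - z0| <= rho.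
  rewrite leNgt; apply/negP => h; move: lt_Vw; rewrite ltNge => /negP; apply.
  apply: env_le_mono => //; apply/near_normP; exists (`|z - z0| - rho).
    by rewrite subr_gt0.
  move=> y yz; have yrho : rho <= `|y - z0|.
    have := ler_normD (z - y) (y - z0); rewrite addrA subrK (distrC z y).
    by lra.
  by rewrite /w; case: ifP => // yr; rewrite ge_max lexx chiV.
have zr : `|z - z0| < r by apply: le_lt_trans rhor.
right; split=> //; apply/eqP; rewrite eq_le; apply/andP; split; last first.
  by apply: le_trans (env_ge bw z); rewrite /w zr le_max lexx orbT.
rewrite leNgt; apply/negP => h.
pose c := Num.max (env V z) (chi z + kap).
have cw : c < env w z by rewrite gt_max lt_Vw.
pose e := (env w z - c) / 2.
have e0 : 0 < e by rewrite divr_gt0// subr_gt0.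
have : env w z <= c + e; last by rewrite /e; lra.
have n1 : \forall y \near z, V y <= c + e.
  have Vc : env V z <= c by rewrite le_max lexx.
  by apply: env_lt_near => //; apply: (le_lt_trans Vc); rewrite ltrDl.
have n2 := continuous_near z chi_cont e0.
apply: env_le => //; move: n1 n2; apply: filterS2 => y Vy.
rewrite ltr_norml => /andP[_ ye]; rewrite /w; case: ifP => // _.
rewrite ge_max Vy /=.
have : chi z + kap <= c by rewrite le_max lexx orbT.
lra.
Qed.

(** Raising [V] to [chi + kap] in the ball yields another member [w] of the class, hence [w <= V] by
    maximality. The ring condition [chiV] makes the change invisible near the boundary of the ball,
    where the two definitions are glued. *)
Lemma perron_bump z : `|z - z0| < r -> chi z + kap <= V z.
Proof.
move=> zr; have bV := bounded_perron.
suff Sw : S w.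
  apply: le_trans (vsup_ge (M := M) _ Sw).
    by rewrite /w zr le_max lexx orbT.
  by move=> u Su; have := SM z Su; rewrite ler_norml => /andP[].
split=> [y|].
  by have /andP[h1 _] := perron_between y; rewrite (le_trans h1 (Vw y)) ww0.
move=> psi y cpsi ty ny.
have [wV|[yr wchi]] := bump_cases y.
  apply: perron_sub => //; first by rewrite -wV.
  move: ny; apply: filterS => x; apply: le_trans.
  by apply: env_le_mono => //; apply/near_normP; exists 1.
(* Here [psi] touches the smooth function [chi + kap] from above, so both have the same gradient and
   the classical inequality [Fchi] applies. *)
have hg := has_gradD ((has_grad_C1 chi).1 cchi) (has_grad_cst kap).
have [cchi' tchi xchi] := C1_has_grad hg.
have [] := @grad_eq_at_touch _ _ psi y cchi' cpsi.
- by rewrite -wchi.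
- have nr : \forall x \near y, `|x - z0| < r.
    apply/near_normP; exists (r - `|y - z0|); first by rewrite subr_gt0.
    move=> x xy; have := ler_normD (x - y) (y - z0); rewrite addrA subrK.
    by lra.
  move: ny nr; apply: filterS2 => x xpsi xr; apply: le_trans xpsi.
  by apply: le_trans (env_ge bw x); rewrite /w xr le_max lexx orbT.
- by rewrite tchi xchi !addr0 => <- <-; rewrite -ty wchi; exact: Fchi.
Qed.

End Bump.

(** Where the super-solution property fails, the reflected test function is locally a strict
    classical sub-solution below [V], and a small bump contradicts the contact. *)
Lemma perron_super : vsub (vneg F) (env (fun z => - V z)).
Proof.
move=> phi z0 cphi tz nz; have bV := bounded_perron.
have bNV := bounded_planeN bV.
have bNw0 : bounded_plane (fun z => - w0 z) by exists M => z; rewrite normrN.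
have w0V z : env (fun z => - w0 z) z <= env (fun z => - V z) z.
  apply: env_le_mono => //; apply/near_normP; exists 1 => // y _.
  by rewrite lerN2; have /andP[] := perron_between y.
rewrite leNgt; apply/negP => F0.
(* If the barrier is also touched by [phi], its own super-solution property concludes; otherwise
   there is room below [w0] for a bump. *)
have [eq_w0|ne_w0] := eqVneq (env (fun z => - w0 z) z0) (phi z0).
  move: F0; rewrite ltNge => /negP; apply; apply: sw0 => //.
  by move: nz; apply: filterS => y; exact: le_trans.
have w0phi : env (fun z => - w0 z) z0 < phi z0.
  by rewrite lt_neqAle ne_w0 -tz w0V.
pose chi z := - add_paraboloid phi z0 z.
have [ca az at_ ax] := C1_add_paraboloid z0 cphi.
have [cchi tchi xchi] := C1_has_grad (has_gradN ((has_grad_C1 _).1 ca)).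
rewrite -/chi in cchi tchi xchi.
have chiz : chi z0 = - phi z0 by rewrite /chi az.
have [d d0 hd] := vcont_near z0 cF cchi F0.
pose gap := phi z0 - env (fun z => - w0 z) z0.
have gap0 : 0 < gap by rewrite subr_gt0.
have gap40 : 0 < gap / 4 by rewrite divr_gt0.
have n1 : \forall y \near z0, - w0 y <= phi z0 - gap / 2.
  by apply: env_lt_near => //; rewrite /gap; lra.
have n2 := continuous_near z0 (C1_continuous cchi) gap40.
have n3 : \forall y \near z0, `|y - z0| < d by apply/near_normP; exists d.
have /near_normP[r r0 hr] : \forall y \near z0,
    [/\ env (fun z => - V z) y <= phi y, chi y + gap / 4 <= w0 y
      & `|y - z0| < d].
  have n4 : \forall y \near z0, chi y + gap / 4 <= w0 y.
    move: n1 n2; apply: filterS2 => y; rewrite chiz ltr_norml => n1 /andP[_].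
    by lra.
  by move: nz n4 n3; apply: filterS3 => y; split.
pose rho := r / 2.
have rho0 : 0 < rho by rewrite divr_gt0.
have rho2 : 0 < rho ^+ 2 by rewrite exprn_gt0.
(* The three bounds keep the bump below [w0], keep it a sub-solution, and keep it below [V] on the
   ring, where the paraboloid is at least [rho ^ 2]. *)
pose kap := Num.min (Num.min (gap / 4) (d / 2)) (rho ^+ 2).
have kap0 : 0 < kap by rewrite !lt_min gap40 rho2 divr_gt0.
have kapg : kap <= gap / 4 by rewrite /kap !ge_min lexx.
have kapd : kap < d.
  by apply: (@le_lt_trans _ _ (d / 2)); [rewrite /kap !ge_min lexx orbT|lra].
have kaprho : kap <= rho ^+ 2 by rewrite /kap ge_min lexx orbT.
have bump : forall z, `|z - z0| < r -> chi z + kap <= V z.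
  apply: (@perron_bump chi z0 rho) => //.
  - by rewrite /rho; lra.
  - move=> z zr; have [_ _ zd] := hr z zr.
    have := hd z kap zd; rewrite gtr0_norm// => /(_ kapd).
    rewrite chiz !tchi !xchi at_ ax ltr_norml /vneg => /andP[_].
    by rewrite ltrBlDr addNr => /ltW.
  - by move=> z zr; have [_ h _] := hr z zr; lra.
  - move=> z rz zr; have [h _ _] := hr z zr.
    have := env_ge bNV z; have := paraboloid_ge (ltW rho0) rz.
    by rewrite /chi /add_paraboloid; lra.
have : env (fun z => - V z) z0 <= phi z0 - kap / 2; last by rewrite tz; lra.
apply: env_le => //.
have kap20 : 0 < kap / 2 by rewrite divr_gt0.
have n4 := continuous_near z0 (C1_continuous cchi) kap20.
have n5 : \forall y \near z0, `|y - z0| < r by apply/near_normP; exists r.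
move: n4 n5; apply: filterS2 => y; rewrite ltr_norml chiz => /andP[h _] /bump.
by lra.
Qed.

End Solution.

End Perron.

(** * Oscillation of sub-solutions *)

Section Equation.
Context {R : realType}.
Implicit Types (phi u v : R * R -> R) (z : R * R) (G : R -> R -> R -> R)
  (F : R * R -> R -> R -> R -> R).

Definition shift_inv {T : Type} (s : R * R) (f : R * R -> T) :=
  forall z, f (z + s) = f z.

Lemma shift_invN {T : Type} s (f : R * R -> T) :
  shift_inv s f -> shift_inv (- s) f.
Proof. by move=> h z; rewrite -[RHS]h -[in RHS](addrNK s z) h. Qed.

Lemma vsub_shift F u (s : R * R) : shift_inv s F -> vsub F u ->
  vsub F (fun z => u (z + s)).
Proof.
move=> /shift_invN Fs su phi z cphi tz nz.
have [cpsi tpsi xpsi] := C1_has_grad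
  (has_grad_shift (- s) ((has_grad_C1 _).1 cphi)).
have := su _ (z + s) cpsi; rewrite tpsi xpsi addrK -(Fs (z + s)) addrK.
apply => //; move: nz => /near_normP[r r0 hr]; apply/near_normP; exists r => //.
move=> y yz; have := hr (y - s); rewrite subrK; apply.
by rewrite -addrA -opprD [s + z]addrC.
Qed.

Lemma perron_shift F u0 w0 (M : R) s :
  (forall z, `|u0 z| <= M) -> (forall z, `|w0 z| <= M) ->
  (forall z, u0 z <= w0 z) -> vsub F (env u0) ->
  shift_inv s F -> shift_inv s u0 -> shift_inv s w0 ->
  shift_inv s (vsup (perron_class F u0 w0)).
Proof.
move=> u0M w0M u0w0 su0.
set S := perron_class F u0 w0.
have Su0 : S u0 by split => // z; rewrite lexx u0w0.
suff le_shift s' : shift_inv s' F -> shift_inv s' u0 -> shift_inv s' w0 ->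
    forall z, vsup S (z + s') <= vsup S z.
  move=> Fs us ws z; apply/eqP; rewrite eq_le le_shift//=.
  by rewrite -[X in vsup S X <= _](addrK s z) le_shift//; exact: shift_invN.
move=> Fs us ws z; apply: vsup_le; first by exists u0.
move=> u [uS su]; apply: (@vsup_ge _ S (fun y => u (y + s')) z M).
  move=> v [/(_ z) /andP[_ vw] _]; apply: le_trans vw _.
  by apply: le_trans (ler_norm _) _.
split=> [y|]; first by rewrite -(us y) -(ws y).
have -> : env (fun y => u (y + s')) = (fun y => env u (y + s')).
  by apply/funext => y; rewrite env_shift.
exact: vsub_shift.
Qed.

Definition heqn G (k c p : R) z (r a q : R) := k * r + a + G z.1 z.2 (p + q) - c.

Lemma ham_continuousP G : ham_continuous G ->
  forall t x q e : R, 0 < e -> exists2 d : R, 0 < d & forall t' x' q' : R,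
    `|t' - t| < d -> `|x' - x| < d -> `|q' - q| < d ->
    `|G t' x' q' - G t x q| < e.
Proof.
move=> cG t x q e e0.
have /cvgrPdist_lt/(_ e e0)/nbhs_ballP[d /= d0 hd] := cG (t, x, q).
exists d => // t' x' q' ht hx hq; rewrite distrC.
by apply: (hd (t', x', q')); split; first split; rewrite /= -ball_normE /= distrC.
Qed.

Lemma vcont_heqn G (k c p : R) : ham_continuous G -> vcont (heqn G k c p).
Proof.
move=> cG z r a q e e0.
have e40 : 0 < e / 4 by rewrite divr_gt0.
have k1 : 0 < `|k| + 1 by rewrite ltr_wpDl.
have [d d0 hd] := ham_continuousP cG z.1 z.2 (p + q) e40.
exists (Num.min (Num.min d (e / 4)) (e / 4 / (`|k| + 1))).
  by rewrite !lt_min d0 e40 divr_gt0.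
move=> z' r' a' q'; rewrite !lt_min.
move=> /andP[/andP[zd _] _] /andP[_ rd] /andP[/andP[_ ad] _].
move=> /andP[/andP[qd _] _].
move: zd; rewrite norm_pair_lt /= => /andP[z1 z2].
have := hd z'.1 z'.2 (p + q') z1 z2.
rewrite [p + q' - _]addrC opprD addrACA addrA addNr add0r [- q + _]addrC => /(_ qd).
have kr : `|k * r' - k * r| < e / 4.
  rewrite -mulrBr normrM; apply: (@le_lt_trans _ _ ((`|k| + 1) * `|r' - r|)).
    by rewrite ler_wpM2r// lerDl.
  by rewrite mulrC -ltr_pdivlMr.
rewrite /heqn; move: kr ad; rewrite !ltr_norml.
move=> /andP[? ?] /andP[? ?] /andP[? ?].
by apply/andP; split; lra.
Qed.

Lemma visc_subsolutionE G (p c : R) u : bounded_plane u ->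
  visc_subsolution (fun t x q => G t x (p + q)) c u <->
  vsub (heqn G 0 c p) (env u).
Proof.
move=> bu; split=> su phi z cphi.
  move=> tz nz; have := su phi z cphi.
  rewrite /heqn mul0r add0r subr_le0; apply; split.
    by rewrite usc_envelopeE// tz.
  by move: nz; apply: filterS => y; rewrite usc_envelopeE// lee_fin.
move=> [tz nz]; have := su phi z cphi.
rewrite /heqn mul0r add0r subr_le0; apply.
  by move: tz; rewrite usc_envelopeE// => -[].
by move: nz; apply: filterS => y; rewrite usc_envelopeE// lee_fin.
Qed.

Lemma visc_supersolutionE G (p c : R) u : bounded_plane u ->
  visc_supersolution (fun t x q => G t x (p + q)) c u <->
  vsub (vneg (heqn G 0 c p)) (env (fun z => - u z)).
Proof.
move=> bu; split=> su phi z cphi.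
  have [cpsi tpsi xpsi] := C1_has_grad (has_gradN ((has_grad_C1 _).1 cphi)).
  move=> tz nz; have := su _ z cpsi; rewrite tpsi xpsi.
  rewrite /vneg /heqn mul0r add0r oppr_le0 subr_ge0; apply; split.
    by rewrite lsc_envelopeE// tz.
  by move: nz; apply: filterS => y; rewrite lsc_envelopeE// lee_fin lerN2.
have [cpsi tpsi xpsi] := C1_has_grad (has_gradN ((has_grad_C1 _).1 cphi)).
move=> [tz nz]; have := su _ z cpsi; rewrite tpsi xpsi.
rewrite /vneg /heqn mul0r add0r oppr_le0 subr_ge0 !opprK; apply.
  by move: tz; rewrite lsc_envelopeE// => -[<-]; rewrite opprK.
move: nz; apply: filterS => y; rewrite lsc_envelopeE// lee_fin.
by rewrite lerNr.
Qed.

(** * Growth along transport lines and oscillation *)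

Section Transport.
Variables (U : R * R -> R) (B b K K' : R).
Hypotheses (uU : usc U) (UB : forall z, `|U z| <= B)
  (tests : forall phi z, C1 phi -> U z = phi z ->
    (\forall y \near z, U y <= phi y) -> dt phi z + b * dx phi z <= K)
  (KK' : K < K') (K'0 : 0 < K').

(* The test function K' (t - s) + N (x - y - b (t - s))^2 has derivative K' > K
   along the transport direction, so U minus it is maximal at time s. *)
Lemma transport_le (s y tau : R) : 0 <= tau ->
  U (s + tau, y + b * tau) <= U (s, y) + K' * tau.
Proof.
move=> tau0; have K'p := K'0.
have UB' z : - B <= U z <= B by rewrite -ler_norml.
have B0 : 0 <= B by apply: le_trans (UB (s, y)).
apply/ler_addgt0Pr => e e0.
have /near_normP[r r0 hr] := uU (s, y) e0.
(* At distance [r] or more from [y] the space penalty alone outweighs the range [2 B] of [U];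
   closer, semi-continuity at [(s, y)] is at hand. *)
pose N := 2 * B / r ^+ 2 + 1.
have r20 : 0 < r ^+ 2 by rewrite exprn_gt0.
have Nr : 2 * B < N * r ^+ 2.
  by rewrite /N [ltRHS]mulrDl mul1r divfK ?gt_eqF// ltrDl.
have N0 : 0 < N by rewrite /N ltr_wpDl// divr_ge0 ?mulr_ge0// ltW.
(* [K' T > 2 B], so at time [s + T] or later [g] is below [- B] and the maximum over the box avoids
   that face; [A] and [C] play the same role in space. *)
pose T := tau + 2 * B / K' + 1.
have BK0 : 0 <= 2 * B / K' by rewrite divr_ge0 ?mulr_ge0// ltW.
have KT : 2 * B < K' * T.
  have -> : K' * T = K' * tau + 2 * B + K'.
    by rewrite /T !mulrDr mulr1 mulrCA divff ?gt_eqF// mulr1.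
  have : 0 <= K' * tau by rewrite mulr_ge0// ltW.
  by lra.
have tauT : tau < T by rewrite /T; lra.
pose A := 2 * B / N + 1.
have A1 : 1 <= A by rewrite /A lerDr divr_ge0 ?mulr_ge0// ltW.
have NA : 2 * B < N * A ^+ 2.
  apply: (@lt_le_trans _ _ (N * A)).
    by rewrite /A mulrDr mulr1 mulrCA divff ?gt_eqF// mulr1 ltrDl.
  by rewrite ler_pM2l// expr2 ler_peMl// ; lra.
pose C := A + `|b| * T.
pose rh z : R := - b * z.1 + 1 * z.2 + (b * s - y).
pose phi z : R := K' * z.1 + 0 * z.2 + - (K' * s) + N * rh z ^+ 2.
pose g z := U z - phi z.
have [cphi tphi xphi] := C1_has_grad (has_gradD
   (has_grad_affine K' 0 (- (K' * s)))
   (has_gradZ N (has_grad_sq (- b) 1 (b * s - y)))).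
rewrite -[X in C1 X]/phi in cphi tphi xphi.
have ug : usc g.
  move=> z d d0; have d20 : 0 < d / 2 by rewrite divr_gt0.
  have n1 := uU z d20; have n2 := continuous_near z (C1_continuous cphi) d20.
  move: n1 n2; apply: filterS2 => x h1; rewrite ltr_norml => /andP[h2 _].
  by rewrite /g; lra.
have confined z : s <= z.1 -> - B <= g z ->
    z.1 < s + T /\ `|z.2 - y| < C.
  move=> sz gB; have /andP[_ UzB] := UB' z.
  have rh0 : 0 <= N * rh z ^+ 2 by rewrite mulr_ge0 ?sqr_ge0// ltW.
  have K0 : 0 <= K' * (z.1 - s) by rewrite mulr_ge0 ?subr_ge0// ltW.
  have phiE : phi z = K' * (z.1 - s) + N * rh z ^+ 2.
    by rewrite /phi mul0r addr0 mulrBr.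
  have zT : z.1 < s + T.
    rewrite ltNge -lerBrDl; apply/negP => h.
    have : K' * T <= K' * (z.1 - s) by rewrite ler_pM2l.
    by move: gB; rewrite /g phiE; lra.
  split => //.
  have rA : `|rh z| < A.
    rewrite ltNge; apply/negP => h.
    have : N * A ^+ 2 <= N * rh z ^+ 2.
      by rewrite ler_pM2l// -[leRHS]real_normK ?num_real// lerXn2r// nnegrE; lra.
    by move: gB; rewrite /g phiE; lra.
  have -> : z.2 - y = rh z + b * (z.1 - s) by rewrite /rh; ring.
  apply: (le_lt_trans (ler_normD _ _)); apply: ltr_leD => //.
  rewrite normrM ler_wpM2l// ger0_norm ?subr_ge0//; lra.
have T0 : 0 <= T by lra.
have C0 : 0 <= C by rewrite addr_ge0 ?mulr_ge0//; lra.
have cbox : compact (`[s, s + T]%classic `*` `[y - C, y + C]%classic).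
  by apply: compact_setX; exact: segment_compact.
have inbox z : s <= z.1 -> z.1 <= s + T -> `|z.2 - y| <= C ->
    (`[s, s + T]%classic `*` `[y - C, y + C]%classic) z.
  move=> h1 h2; rewrite ler_norml => /andP[h3 h4]; split => /=.
    by rewrite in_itv /= h1.
  by rewrite in_itv /=; apply/andP; split; lra.
have [|z1 [/=]] := usc_max ug cbox.
  by exists (s, y); apply: inbox => /=; rewrite ?subrr ?normr0//; lra.
rewrite !in_itv /= => /andP[sz1 _] _ z1max.
have gsy : g (s, y) = U (s, y).
  by rewrite /g /phi /rh /= (_ : - b * s + _ + _ = 0); [ring|ring].
have gz1 : - B <= g z1.
  have /andP[h _] := UB' (s, y); apply: (le_trans h); rewrite -gsy.
  by apply: z1max; apply: inbox => /=; rewrite ?subrr ?normr0//; lra.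
have [z1T z1C] := confined z1 sz1 gz1.
have z1s : z1.1 = s.
  apply/eqP; rewrite eq_le sz1 andbT leNgt; apply/negP => lt_s.
  have [cpsi tpsi xpsi] := C1_has_grad (has_gradD ((has_grad_C1 _).1 cphi)
    (has_grad_cst (g z1))).
  have := tests (z := z1) cpsi; rewrite tpsi xpsi !addr0 tphi xphi.
  have -> : K' + N * (2 * - b * rh z1) + b * (0 + N * (2 * 1 * rh z1)) = K' by ring.
  rewrite leNgt KK' => h; suff : false by []; apply: h.
    by rewrite /g; lra.
  apply/near_normP; exists (Num.min (Num.min (z1.1 - s) (s + T - z1.1))
      (C - `|z1.2 - y|)).
    by rewrite !lt_min; apply/andP; split; [apply/andP; split|]; lra.
  move=> x; rewrite norm_pair_lt !lt_min => /andP[/andP[/andP[h1 h2] _]].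
  move=> /andP[_ h3].
  have : g x <= g z1.
    apply: z1max; move: h1 h2 => /=; rewrite !ltr_norml.
    move=> /andP[? ?] /andP[? ?]; apply: inbox; [lra|lra|].
    have -> : x.2 - y = (x.2 - z1.2) + (z1.2 - y) by ring.
    by apply: (le_trans (ler_normD _ _)); move: h3 => /=; lra.
  by rewrite /g; lra.
have le1 : g (s + tau, y + b * tau) <= g z1.
  apply: z1max; apply: inbox => /=; [lra|lra|].
  rewrite addrAC subrr add0r normrM (ger0_norm tau0).
  have : `|b| * tau <= `|b| * T by rewrite ler_wpM2l// ltW.
  by rewrite /C; lra.
have gtau : g (s + tau, y + b * tau) = U (s + tau, y + b * tau) - K' * tau.
  by rewrite /g /phi /rh /=; ring.
have gz1E : g z1 = U z1 - N * (z1.2 - y) ^+ 2.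
  by rewrite /g /phi /rh z1s; ring.
have N1 : 0 <= N * (z1.2 - y) ^+ 2 by rewrite mulr_ge0 ?sqr_ge0// ltW.
have [zr|zr] := ltP `|z1.2 - y| r.
  have := hr z1; rewrite norm_pair_lt /= z1s subrr normr0 r0 zr => /(_ isT).
  by lra.
have : N * r ^+ 2 <= N * (z1.2 - y) ^+ 2.
  by rewrite ler_pM2l// -[leRHS]real_normK ?num_real// lerXn2r// nnegrE ltW.
by have /andP[_ ?] := UB' z1; lra.
Qed.

End Transport.

Lemma int_shift (x : R) : exists k : int, 0 <= x + k%:~R < 1.
Proof.
exists (- Num.floor x); rewrite mulrNz subr_ge0 ge_floor ltrBlDl.
by have := floorD1_gt x; rewrite intrD1.
Qed.

(** Modulo the lattice, [z] is reached from [z'] in a time [tau] between [c^-1] and [c^-1 + 1] with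
    a displacement in [[0, 1)], hence at a speed of at most [c]. The growth rate [K + 1] is any
    number strictly above [K]. *)
Lemma oscillation_le (U : R * R -> R) (B c K : R) : usc U ->
  (forall z, `|U z| <= B) -> Z2_periodic U -> 0 < c -> 0 <= K ->
  (forall b phi z, `|b| <= c -> C1 phi -> U z = phi z ->
    (\forall y \near z, U y <= phi y) -> dt phi z + b * dx phi z <= K) ->
  forall z z', U z <= U z' + (K + 1) * (c^-1 + 1).
Proof.
move=> uU UB pU c0 K0 tests z z'.
have [k /andP[k0 k1]] := int_shift (z.1 - z'.1 - c^-1).
have [j /andP[j0 j1]] := int_shift (z.2 - z'.2).
have ci0 : 0 < c^-1 by rewrite invr_gt0.
pose tau := z.1 - z'.1 + k%:~R.
have tau1 : c^-1 <= tau by rewrite /tau; lra.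
have tau2 : tau <= c^-1 + 1 by rewrite /tau; lra.
have tau0 : 0 < tau by apply: lt_le_trans tau1.
pose b := (z.2 - z'.2 + j%:~R) / tau.
have bc : `|b| <= c.
  rewrite ger0_norm; last by rewrite divr_ge0// ltW.
  rewrite ler_pdivrMr//; apply: (@le_trans _ _ 1); first exact: ltW.
  by rewrite -(mulfV (lt0r_neq0 c0)) ler_pM2l.
have K1 : 0 < K + 1 by lra.
have := @transport_le U B b K (K + 1) uU UB _ _ K1 z'.1 z'.2 tau (ltW tau0).
move=> /(_ (fun phi z => tests b phi z bc)).
have -> : (z'.1 + tau, z'.2 + b * tau) = (z.1 + k%:~R, z.2 + j%:~R).
  by rewrite /b divfK ?gt_eqF// /tau; congr pair; ring.
rewrite pU -!surjective_pairing ltrDl => /(_ ltr01) h.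
by apply: (le_trans h); rewrite lerD2l ler_pM2l.
Qed.

End Equation.

(** * Periodic Hamiltonians *)

Section Hamiltonian.
Context {R : realType}.
Variable G : R -> R -> R -> R.

Definition Z2_periodic_ham := forall (k j : int) (t x p : R),
  G (t + k%:~R) (x + j%:~R) p = G t x p.

Hypotheses (Gc : ham_continuous G) (Gp : Z2_periodic_ham).

Lemma compact_cell (L : R) :
  compact (`[0 : R, 1]%classic `*` `[0 : R, 1]%classic `*` `[- L, L]%classic).
Proof.
by apply: compact_setX; [apply: compact_setX|]; exact: segment_compact.
Qed.

Lemma cell_shift (t x p : R) : exists t' x' : R,
  [/\ 0 <= t' <= 1, 0 <= x' <= 1 &
    exists j : int, x' = x + j%:~R /\
      forall y q : R, G t y q = G t' (y + j%:~R) q].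
Proof.
have [k /andP[k0 k1]] := int_shift t; have [j /andP[j0 j1]] := int_shift x.
exists (t + k%:~R), (x + j%:~R); split.
- by rewrite k0 ltW.
- by rewrite j0 ltW.
- by exists j; split => // y q; rewrite Gp.
Qed.

(** Both values are taken at the same time: shifts in time are left to [time_regular]. *)
Lemma ham_unif_continuous (L e : R) : 0 < e ->
  exists2 d : R, 0 < d & forall t x p x' p' : R, `|p| <= L ->
    `|x' - x| < d -> `|p' - p| < d -> `|G t x' p' - G t x p| < e.
Proof.
move=> e0; have e20 : 0 < e / 2 by rewrite divr_gt0.
pose P (d : R) (z : R * R * R) := forall x' p', `|x' - z.1.2| < d ->
  `|p' - z.2| < d -> `|G z.1.1 x' p' - G z.1.1 z.1.2 z.2| < e.
have covering (z : R * R * R) : \forall y \near z & d \near 0^'+, P d y.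
  have [d d0 hd] := ham_continuousP Gc z.1.1 z.1.2 z.2 e20.
  have d20 : 0 < d / 2 by rewrite divr_gt0.
  exists ([set y | ball z (d / 2) y], [set d' | 0 < d' <= d / 2]) => /=.
    split; first exact: nbhsx_ballx.
    near=> d'; apply/andP; split; first by near: d'; exact: nbhs_right_gt.
    by near: d'; exact: nbhs_right_le.
  move=> [y d'] /= [[[]]]; rewrite -!ball_normE /= ![`|z.1.1 - _|]distrC.
  rewrite ![`|z.1.2 - _|]distrC ![`|z.2 - _|]distrC => h1 h2 h3 /andP[d'0 d'd].
  move=> x' p' hx hp.
  have hx' : `|x' - z.1.2| < d.
    rewrite -(subrK y.1.2 x') -addrA; apply: (le_lt_trans (ler_normD _ _)); lra.
  have hp' : `|p' - z.2| < d.
    rewrite -(subrK y.2 p') -addrA; apply: (le_lt_trans (ler_normD _ _)); lra.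
  have k1 := hd y.1.1 x' p' ltac:(lra) hx' hp'.
  have k2 := hd y.1.1 y.1.2 y.2 ltac:(lra) ltac:(lra) ltac:(lra).
  move: k1 k2; rewrite !ltr_norml => /andP[? ?] /andP[? ?].
  by apply/andP; split; lra.
have /compact_near_coveringP cK := @compact_cell L.
have nP := cK R ((0 : R)^'+) P (at_right_proper_filter (0 : R))
  (fun z _ => covering z).
have n0 : \forall e \near (0 : R)^'+, 0 < e by apply: nbhs_right_gt.
have nn : \forall d \near (0 : R)^'+, 0 < d /\
  (`[0 : R, 1]%classic `*` `[0 : R, 1]%classic `*` `[- L, L]%classic `<=` P d).
  by move: n0 nP; apply: filterS2.
have [d [d0 hd]] := @filter_ex _ _ (at_right_proper_filter (0 : R)) _ nn.
exists d => // t x p x' p' pL hx hp.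
have [t' [y [ht hy [j [yE GE]]]]] := cell_shift t x p.
rewrite !GE -yE; apply: (hd (t', y, p)) => //=; last first.
  by rewrite yE opprD addrACA subrr addr0.
by rewrite !in_itv /= ht hy -ler_norml.
Unshelve. all: by end_near. Qed.

Lemma ham_bounded (L : R) :
  exists M : R, forall t x p : R, `|p| <= L -> `|G t x p| <= M.
Proof.
have uG : usc (fun z : R * R * R => `|G z.1.1 z.1.2 z.2|).
  move=> [[t x] p] e e0; have [d d0 hd] := ham_continuousP Gc t x p e0.
  have : \forall y \near (t, x, p), ball (t, x, p) d y by exact: nbhsx_ballx.
  apply: filterS => -[[t' x'] p'] [[/=]]; rewrite -!ball_normE /= => h1 h2 h3.
  rewrite distrC in h1; rewrite distrC in h2; rewrite distrC in h3.
  rewrite -ltrBlDl; apply: le_lt_trans (lerB_dist _ _) _.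
  exact: hd.
have [L0|L0] := leP 0 L; last first.
  exists 0 => t x p h; have := le_trans (normr_ge0 p) h; lra.
have [|z _ hz] := usc_max uG (@compact_cell L).
  by exists (0, 0, 0) => /=; rewrite !in_itv /= !lexx ler01 oppr_le0 L0.
exists `|G z.1.1 z.1.2 z.2| => t x p pL.
have [t' [y [ht hy [j [yE GE]]]]] := cell_shift t x p.
rewrite GE -yE; apply: (hz (t', y, p)) => /=.
by rewrite !in_itv /= ht hy -ler_norml.
Qed.

Hypotheses (Gco : uniformly_coercive G) (Gt : time_regular G).

(* The gap between the two base points of a doubled variable is harmless: the
   shift in time is absorbed by the time regularity as soon as the time
   penalisation is small, and then the shift in space by uniform continuity,
   since coercivity bounds the momentum once the time penalisation is fixed. *)
Lemma freeze_base_point (l e p : R) : 0 < e ->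
  exists2 kap : R, 0 < kap & forall n : R, 1 <= n ->
  exists2 m0 : R, 1 <= m0 & forall m s x t y : R, m0 <= m ->
    n * (s - t) ^+ 2 <= kap ->
    2 * n * (s - t) + G s x (p + 2 * m * (x - y)) <= l ->
    2 * n * (s - t) + G t y (p + 2 * m * (x - y)) <= l + e.
Proof.
move=> e0; have e20 : 0 < e / 2 by rewrite divr_gt0.
have [w [[w0 wmono wlim] Gw]] := Gt.
have [rho rho0 hrho] : exists2 rho : R, 0 < rho &
    forall r, 0 <= r -> r < rho -> w r < e / 2.
  have /cvgrPdist_lt/(_ _ e20) := wlim.
  rewrite near_withinE => /nbhs_normP[rho /= rho0 hrho]; exists rho => // r r0 rr.
  have [->|rn0] := eqVneq r 0; first by rewrite w0.
  have := hrho r; rewrite /= sub0r normrN ger0_norm// => /(_ rr).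
  rewrite lt_def rn0 r0 sub0r normrN => /(_ isT); exact: le_lt_trans (ler_norm _).
(* With [kap = c ^ 2] and [n >= 1], the time gap is at most [c <= 1], and the argument of [w] is at
   most [c (1 + |l|) + 2 c ^ 2 <= c (3 + |l|)]; the 4 leaves a strict margin below [rho]. *)
pose c := Num.min 1 (rho / (4 + `|l|)).
have l4 : 0 < 4 + `|l| by rewrite ltr_wpDr.
have c0 : 0 < c by rewrite lt_min ltr01 divr_gt0.
have c1 : c <= 1 by rewrite ge_min lexx.
have cl : c * (4 + `|l|) <= rho.
  by rewrite -ler_pdivlMr// ge_min lexx orbT.
exists (c ^+ 2); first by rewrite exprn_gt0.
move=> n n1.
(* The momentum bound depends on [n], so [m0] has to be chosen after [n]; it forces [|x - y| < d]
   because [2 m |x - y|] is at most [|K| + |p|]. *)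
have [K hK] := Gco (`|l| + 2 * n + 1).
have [d d0 hd] := ham_unif_continuous K e20.
exists (Num.max 1 ((`|K| + `|p|) / d + 1)); first by rewrite le_max lexx.
move=> m s x t y; rewrite ge_max => /andP[m1 md] nst hl.
pose tau := `|s - t|.
have tau0 : 0 <= tau by exact: normr_ge0.
have tau2 : (s - t) ^+ 2 = tau ^+ 2 by rewrite real_normK ?num_real.
rewrite tau2 in nst.
have ntau0 : 0 <= n * tau by rewrite mulr_ge0//; lra.
have c2c : c ^+ 2 <= c by rewrite expr2 ler_piMl// ltW.
have tauc : tau <= c.
  rewrite -(@ler_pXn2r _ 2)// ?nnegrE//; last exact: ltW.
  by apply: le_trans nst; rewrite ler_peMl// sqr_ge0.
have ntau : n * tau <= n.
  by rewrite ler_piMr//; lra.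
set P := p + _ in hl *.
have sgn : - tau <= s - t <= tau by rewrite -ler_norml.
have nsgn : - (n * tau) <= n * (s - t) <= n * tau.
  have n0 : 0 <= n by lra.
  move: sgn => /andP[h1 h2]; apply/andP; split.
    by rewrite -mulrN ler_wpM2l.
  by rewrite ler_wpM2l.
have GP : G s x P <= `|l| + 2 * (n * tau).
  by have := ler_norm l; move: nsgn => /andP[h1 h2]; lra.
have PK : `|P| <= K.
  rewrite leNgt; apply/negP => /ltW /hK/(_ s x) GM.
  by clear -GM GP ntau; lra.
have xyd : `|x - y| < d.
  rewrite ltNge; apply/negP => dxy.
  have h1 : m * d <= m * `|x - y| by rewrite ler_wpM2l//; lra.
  have h2 : `|K| + `|p| < m * d.
    rewrite -ltr_pdivrMr//; apply: lt_le_trans md; lra.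
  have h3 : 2 * (m * `|x - y|) <= `|K| + `|p|.
    have -> : 2 * (m * `|x - y|) = `|2 * m * (x - y)|.
      by rewrite normrM ger0_norm ?mulrA//; lra.
    have -> : 2 * m * (x - y) = P - p by rewrite /P; ring.
    apply: (le_trans (ler_normB _ _)); rewrite lerD2r.
    exact: le_trans PK (ler_norm _).
  have h4 : 0 <= m * d by rewrite mulr_ge0//; lra.
  by clear -h1 h2 h3 h4; lra.
have GX : G t y P - G t x P < e / 2.
  apply: (le_lt_trans (ler_norm _)); apply: hd => //; first by rewrite distrC.
  by rewrite subrr normr0.
have GT : G t x P - G s x P < e / 2.
  apply: (le_lt_trans (Gw t s x P)); rewrite distrC -/tau; apply: hrho.
    by rewrite mulr_ge0// addr_ge0// le_max lexx orbT.
  apply: (@le_lt_trans _ _ (tau * (1 + (`|l| + 2 * (n * tau))))).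
    rewrite ler_wpM2l// lerD2l ge_max GP /= addr_ge0// mulr_ge0//.
  have -> : tau * (1 + (`|l| + 2 * (n * tau))) =
    tau * (1 + `|l|) + 2 * (n * tau ^+ 2) by ring.
  have h1 : tau * (1 + `|l|) <= c * (1 + `|l|) by rewrite ler_wpM2r// addr_ge0.
  by clear -h1 nst c2c cl c0; lra.
by clear -hl GX GT; lra.
Qed.

End Hamiltonian.

(** * Comparison by doubling variables *)

Section Doubling.
Context {R : realType}.

(** Taking the infimum over [m] first lets [n] be chosen before [m]. If each doubling of [n] along
    the powers of 2 lost more than [eta / 2], the bounded infimum would be exhausted. *)
Lemma small_drop (g : R -> R -> R) (C : R) :
  (forall n m, 1 <= n -> 1 <= m -> `|g n m| <= C) ->
  (forall n m n' m', 1 <= n -> n <= n' -> 1 <= m -> m <= m' ->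
     g n' m' <= g n m) ->
  forall eta : R, 0 < eta -> exists2 n : R, 1 <= n &
    exists2 m1 : R, 1 <= m1 &
      forall m, m1 <= m -> g n m - g (2 * n) (2 * m) <= eta.
Proof.
move=> gC gmono eta eta0; have eta20 : 0 < eta / 2 by rewrite divr_gt0.
pose A n := [set g n m | m in [set m | 1 <= m]].
pose f n := inf (A n).
have A0 n : A n !=set0 by exists (g n 1), 1 => //=; exact: lexx.
have Alb n : 1 <= n -> has_lbound (A n).
  move=> n1; exists (- C) => _ [m /= m1 <-].
  by have := gC n m n1 m1; rewrite ler_norml => /andP[].
have fle n m : 1 <= n -> 1 <= m -> f n <= g n m.
  by move=> n1 m1; apply: ge_inf; [exact: Alb|exists m].
have fC n : 1 <= n -> - C <= f n.
  move=> n1; apply: lb_le_inf => // _ [m /= m1 <-].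
  by have := gC n m n1 m1; rewrite ler_norml => /andP[].
have [n n1 fn] : exists2 n : R, 1 <= n & f n - f (2 * n) <= eta / 2.
  apply: contrapT => nex.
  have drop n : 1 <= n -> f (2 * n) < f n - eta / 2.
    move=> n1; rewrite ltNge; apply/negP => h; apply: nex; exists n => //.
    by lra.
  have pow1 (k : nat) : 1 <= 2 ^+ k :> R by rewrite exprn_ege1// ler1n.
  have fk (k : nat) : f (2 ^+ k) <= C - (eta / 2) *+ k.
    elim: k => [|k IH].
      rewrite expr0 mulr0n subr0; apply: (le_trans (fle 1 1 _ _)) => //.
      by have := gC 1 1 (lexx _) (lexx _); rewrite ler_norml => /andP[].
    rewrite exprS [_ *+ k.+1]mulrSr opprD addrA; apply: ltW.
    by apply: (lt_le_trans (drop _ (pow1 k))); rewrite lerD2r.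
  pose k := Num.bound (2 * C / (eta / 2)).
  have C0 : 0 <= C by apply: le_trans (gC 1 1 (lexx _) (lexx _)).
  have hk : 2 * C < (eta / 2) *+ k.
    rewrite -[_ *+ k]mulr_natl -ltr_pdivrMr//; apply: archi_boundP.
    by rewrite divr_ge0 ?mulr_ge0// ltW.
  have := le_trans (fC _ (pow1 k)) (fk k); set x := _ *+ k.
  by rewrite /x => h; move: hk h; clear; lra.
exists n => //.
have [_ [m1 /= m11 <-] hm1] :=
  @inf_adherent _ (A n) _ eta20 (conj (A0 n) (Alb n n1)).
exists m1 => // m m1m.
have h1 : f (2 * n) <= g (2 * n) (2 * m) by apply: fle; lra.
have h2 : g n m <= g n m1 by apply: gmono.
by rewrite -/(f n) in hm1; lra.
Qed.

Lemma usc_continuous {T : topologicalType} (f : T -> R) : continuous f -> usc f.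
Proof.
move=> cf z e e0; have /cvgrPdist_lt/(_ e e0) := cf z.
by apply: filterS => y; rewrite distrC ltr_norml => /andP[_]; lra.
Qed.

Lemma usc_comp {T T' : topologicalType} (U : T' -> R) (f : T -> T') :
  usc U -> continuous f -> usc (U \o f).
Proof. by move=> uU cf z e e0; exact: (cf z _ (uU (f z) e e0)). Qed.

Lemma uscD {T : topologicalType} (U V : T -> R) : usc U -> usc V ->
  usc (fun z => U z + V z).
Proof.
move=> uU uV z e e0; have e20 : 0 < e / 2 by rewrite divr_gt0.
have := uV z _ e20; have := uU z _ e20; apply: filterS2 => y h1 h2; lra.
Qed.

Lemma uscZ {T : topologicalType} (c : R) (U : T -> R) : 0 < c -> usc U ->
  usc (fun z => c * U z).
Proof.
move=> c0 uU z e e0; have := uU z (e / c); rewrite divr_gt0// => /(_ isT).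
apply: filterS => y; rewrite -(ltr_pM2l c0) mulrDr mulrCA divff ?gt_eqF//.
by rewrite mulr1.
Qed.

Definition penalty (n m : R) (z z' : R * R) : R :=
  n * (z.1 - z'.1) ^+ 2 + m * (z.2 - z'.2) ^+ 2.

Lemma penalty_grad n m (z' : R * R) : has_grad (fun z => penalty n m z z')
  (fun z => 2 * n * (z.1 - z'.1)) (fun z => 2 * m * (z.2 - z'.2)).
Proof.
apply: (has_grad_eq (has_gradD (has_gradZ n (has_grad_sq 1 0 (- z'.1)))
  (has_gradZ m (has_grad_sq 0 1 (- z'.2))))) => z; rewrite /penalty; ring.
Qed.

Lemma penaltyC n m (z z' : R * R) : penalty n m z z' = penalty n m z' z.
Proof. by rewrite /penalty; ring. Qed.

Lemma penalty_ge0 n m (z z' : R * R) : 0 <= n -> 0 <= m ->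
  0 <= penalty n m z z'.
Proof. by move=> n0 m0; rewrite addr_ge0// mulr_ge0// sqr_ge0. Qed.

Lemma penalty_center n m (z : R * R) : penalty n m z z = 0.
Proof. by rewrite /penalty; ring. Qed.

Lemma penalty_dist n m (z z' : R * R) (c : R) : 1 <= n -> 1 <= m ->
  penalty n m z z' <= c -> `|z - z'| <= c + 1.
Proof.
move=> n1 m1 h.
have sq (x k : R) : 1 <= k -> `|x| <= k * x ^+ 2 + 1.
  move=> k1; have h1 : x ^+ 2 <= k * x ^+ 2 by rewrite ler_peMl// sqr_ge0.
  have h2 := sqr_ge0 (`|x| - 1); have h3 : `|x| ^+ 2 = x ^+ 2.
    by rewrite real_normK ?num_real.
  have h4 := normr_ge0 x.
  move: h2; rewrite sqrrB h3 mulr1 expr1n; lra.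
have s0 (x k : R) : 1 <= k -> 0 <= k * x ^+ 2.
  by move=> k1; rewrite mulr_ge0 ?sqr_ge0//; lra.
rewrite norm_pair_le /=; move: h; rewrite /penalty => h; apply/andP; split.
  have := sq (z.1 - z'.1) n n1; have := s0 (z.2 - z'.2) m m1; lra.
have := sq (z.2 - z'.2) m m1; have := s0 (z.1 - z'.1) n n1; lra.
Qed.

End Doubling.

Section Comparison.
Context {R : realType}.
Implicit Types (phi u v : R * R -> R) (z : R * R).

(** A property of the gradients at contact replaces the inequality, so that a fact such as a
    vanishing time derivative travels together with the equation. *)
Definition tests_above u (Q : R * R -> R -> R -> Prop) :=
  forall phi z, C1 phi -> u z = phi z -> (\forall y \near z, u y <= phi y) ->
    Q z (dt phi z) (dx phi z).

Local Notation plane := (R * R)%type.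
Local Notation triple := (plane * plane * plane)%type.

Lemma continuous_penalty (n m : R) (T : topologicalType) (f g : T -> plane) :
  continuous f -> continuous g -> continuous (fun x => penalty n m (f x) (g x)).
Proof.
move=> cf cg x.
have h1 : (fun y => (f y).1) @ x --> (f x).1 by apply: cvg_comp (cf x) cvg_fst.
have h2 : (fun y => (f y).2) @ x --> (f x).2 by apply: cvg_comp (cf x) cvg_snd.
have k1 : (fun y => (g y).1) @ x --> (g x).1 by apply: cvg_comp (cg x) cvg_fst.
have k2 : (fun y => (g y).2) @ x --> (g x).2 by apply: cvg_comp (cg x) cvg_snd.
apply: cvgD; apply: cvgMr.
  by apply: (cvg_comp _ (fun y : R => y ^+ 2)) (@exprn_continuous _ 2 _); apply: cvgB.
by apply: (cvg_comp _ (fun y : R => y ^+ 2)) (@exprn_continuous _ 2 _); apply: cvgB.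
Qed.

Section Doubled.
Variables (u1 u2 w : plane -> R) (B th : R).
Hypotheses (uu1 : usc u1) (uu2 : usc u2) (uw : usc w)
  (bu1 : forall z, `|u1 z| <= B) (bu2 : forall z, `|u2 z| <= B)
  (bw : forall z, `|w z| <= B)
  (pu1 : Z2_periodic u1) (pu2 : Z2_periodic u2) (pw : Z2_periodic w)
  (th0 : 0 < th) (th1 : th < 1).

(** Both sub-solution variables are tied to the variable of [w], with weights [th] and [1 - th]: at
    a maximum, the gradient seen by the super-solution is the convex combination of those seen by
    the sub-solutions. *)
Definition doubled (n m : R) (X : triple) : R :=
  th * (u1 X.1.1 - penalty n m X.1.1 X.2)
  + (1 - th) * (u2 X.1.2 - penalty n m X.1.2 X.2) + w X.2.

Lemma usc_doubled n m : usc (doubled n m).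
Proof.
have c1 : continuous (fun X : triple => X.1.1).
  by move=> X; apply: cvg_comp cvg_fst cvg_fst.
have c2 : continuous (fun X : triple => X.1.2).
  by move=> X; apply: cvg_comp cvg_fst cvg_snd.
have c3 : continuous (fun X : triple => X.2) by move=> X; exact: cvg_snd.
have pen (f : triple -> plane) : continuous f ->
    usc (fun X => - penalty n m (f X) X.2).
  move=> cf; apply: usc_continuous => X; apply: cvgN.
  exact: (continuous_penalty cf c3).
have t1 : 0 < 1 - th by have := th1; lra.
apply: uscD; last exact: (usc_comp uw c3).
apply: uscD; apply: uscZ => //; apply: uscD; try exact: pen.
  exact: (usc_comp uu1 c1).
exact: (usc_comp uu2 c2).
Qed.

Lemma doubled_le n m X : 1 <= n -> 1 <= m ->
  doubled n m X + th * penalty n m X.1.1 X.2 + (1 - th) * penalty n m X.1.2 X.2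
    <= 2 * B.
Proof.
move=> n1 m1; rewrite /doubled.
have h1 := le_trans (ler_norm _) (bu1 X.1.1).
have h2 := le_trans (ler_norm _) (bu2 X.1.2).
have h3 := le_trans (ler_norm _) (bw X.2).
have h4 : th * u1 X.1.1 <= th * B by rewrite ler_wpM2l// ltW.
have h5 : (1 - th) * u2 X.1.2 <= (1 - th) * B by rewrite ler_wpM2l// subr_ge0 ltW.
lra.
Qed.

Lemma doubled_diag n m z : - (2 * B) <= doubled n m (z, z, z).
Proof.
rewrite /doubled /= !penalty_center !subr0.
have : - B <= u1 z by have := bu1 z; rewrite ler_norml => /andP[].
have : - B <= u2 z by have := bu2 z; rewrite ler_norml => /andP[].
have : - B <= w z by have := bw z; rewrite ler_norml => /andP[].
move=> h3 h2 h1.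
have h4 : th * - B <= th * u1 z by rewrite ler_wpM2l// ltW.
have h5 : (1 - th) * - B <= (1 - th) * u2 z by rewrite ler_wpM2l// subr_ge0 ltW.
lra.
Qed.

(** A common lattice shift brings the third variable into the unit cell; the penalties confine the
    other two. *)
Lemma doubled_max n m : 1 <= n -> 1 <= m ->
  exists X, forall Y, doubled n m Y <= doubled n m X.
Proof.
move=> n1 m1; have B0 : 0 <= B by apply: le_trans (bw (0, 0)).
have t0 := th0; have t1 : 0 < 1 - th by have := th1; lra.
(* A competitor for the maximum has penalties at most [4 B / th] and [4 B / (1 - th)];
   [penalty_dist] adds 1 and the position of the third variable another 1. *)
pose A := 4 * B / th + 4 * B / (1 - th) + 2.
have A1 : 4 * B / th + 2 <= A.
  by rewrite /A lerD2r lerDl divr_ge0 ?mulr_ge0// ltW.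
have A2 : 4 * B / (1 - th) + 2 <= A.
  by rewrite /A lerD2r lerDr divr_ge0 ?mulr_ge0// ltW.
have A0 : 0 <= A.
  by apply: le_trans A1; rewrite addr_ge0 ?divr_ge0 ?mulr_ge0// ltW.
have cK : compact ([set z : plane | `|z - 0| <= A]
    `*` [set z : plane | `|z - 0| <= A] `*` [set z : plane | `|z - 0| <= 1]).
  by apply: compact_setX; [apply: compact_setX|]; exact: compact_cball.
have [|X _ hX] := usc_max (@usc_doubled n m) cK.
  by exists (0, 0, 0) => /=; rewrite !subr0 normr0.
exists X => Y; rewrite leNgt; apply/negP => XY.
have [k /andP[k0 k1]] := int_shift Y.2.1.
have [j /andP[j0 j1]] := int_shift Y.2.2.
pose s (z : plane) : plane := (z.1 + k%:~R, z.2 + j%:~R).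
have pens z z' : penalty n m (s z) (s z') = penalty n m z z'.
  by rewrite /penalty /s /=; ring.
have us u z : Z2_periodic u -> u (s z) = u z.
  by move=> pu; rewrite /s pu -surjective_pairing.
pose Z : triple := (s Y.1.1, s Y.1.2, s Y.2).
have ZY : doubled n m Z = doubled n m Y.
  by rewrite /doubled /= !pens !us.
have XD : doubled n m (0, 0, 0) <= doubled n m X.
  by apply: hX => /=; rewrite !subr0 normr0.
have hD := doubled_diag n m 0.
have hle := doubled_le Z n1 m1.
have n0 : 0 <= n by lra.
have m0 : 0 <= m by lra.
have p1 : 0 <= th * penalty n m Z.1.1 Z.2 by rewrite mulr_ge0 ?penalty_ge0// ltW.
have p2 : 0 <= (1 - th) * penalty n m Z.1.2 Z.2.
  by rewrite mulr_ge0 ?penalty_ge0// ltW.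
have q1 : penalty n m Z.1.1 Z.2 <= 4 * B / th.
  rewrite ler_pdivlMr// mulrC; rewrite ZY in hle; lra.
have q2 : penalty n m Z.1.2 Z.2 <= 4 * B / (1 - th).
  rewrite ler_pdivlMr// mulrC; rewrite ZY in hle; lra.
have d1 := penalty_dist n1 m1 q1; have d2 := penalty_dist n1 m1 q2.
have d3 : `|Z.2 - 0| <= 1.
  by rewrite subr0 norm_pair_le /= (ger0_norm k0) (ger0_norm j0) !ltW.
have : doubled n m Z <= doubled n m X; last by rewrite ZY leNgt XY.
apply: hX; split => //=; split => /=.
  rewrite -[s Y.1.1](subrK Z.2) -addrA; apply: (le_trans (ler_normD _ _)).
  by move: d1 d3 A1; rewrite /=; lra.
rewrite -[s Y.1.2](subrK Z.2) -addrA; apply: (le_trans (ler_normD _ _)).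
by move: d2 d3 A2; rewrite /=; lra.
Qed.

(* The maximum of the functional bounds twice over the penalty by what it gains
   when both weights are halved, and that gain is small at some scale n. *)
Lemma doubled_small_penalty (kap : R) : 0 < kap ->
  exists2 n : R, 1 <= n & exists2 m1 : R, 1 <= m1 &
    forall m, m1 <= m -> exists X, [/\ forall Y, doubled n m Y <= doubled n m X,
      n * (X.1.1.1 - X.2.1) ^+ 2 <= kap & n * (X.1.2.1 - X.2.1) ^+ 2 <= kap].
Proof.
move=> kap0; have t0 := th0; have t1 : 0 < 1 - th by have := th1; lra.
pose g n m := sup [set doubled n m X | X in setT].
have gmax n m : 1 <= n -> 1 <= m -> exists2 X, g n m = doubled n m X &
    forall Y, doubled n m Y <= g n m.
  move=> n1 m1; have [X hX] := doubled_max n1 m1; exists X.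
    apply/eqP; rewrite eq_le; apply/andP; split.
      by apply: ge_sup => [|_ [Y _ <-]//]; exists (doubled n m X), X.
    apply: ub_le_sup; last by exists X.
    by exists (doubled n m X) => _ [Y _ <-].
  move=> Y; apply: ub_le_sup; last by exists Y.
  by exists (doubled n m X) => _ [Z _ <-].
have pen_mono n m n' m' z z' : 1 <= n -> n <= n' -> 1 <= m -> m <= m' ->
    penalty n m z z' <= penalty n' m' z z'.
  by move=> _ nn' _ mm'; apply: lerD; rewrite ler_wpM2r// sqr_ge0.
have [|||n n1 [m1 m11 hm]] := @small_drop R g (2 * B) _ _
    (kap * Num.min th (1 - th) / 2).
- move=> n m n1 m1; have [X gX hX] := gmax n m n1 m1.
  rewrite ler_norml; apply/andP; split.
    by apply: le_trans (hX (0, 0, 0)); exact: doubled_diag.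
  rewrite gX; apply: le_trans (doubled_le X n1 m1); rewrite -addrA lerDl.
  by rewrite addr_ge0// mulr_ge0 ?penalty_ge0//; lra.
- move=> n m n' m' n1 nn' m1 mm'.
  have [X gX hX] := gmax n' m' (le_trans n1 nn') (le_trans m1 mm').
  have [Y _ hY] := gmax n m n1 m1.
  rewrite gX; apply: le_trans (hY X); rewrite /doubled lerD2r.
  have t0' := ltW t0; have t1' := ltW t1.
  by apply: lerD; rewrite ler_wpM2l// lerD2l lerN2 pen_mono.
- by rewrite divr_gt0// mulr_gt0// lt_min t0.
(* The point used is the maximum at the doubled weights. Its penalties are twice those at
   [(n, m / 2)], so passing to these weights gains half of the weighted penalty, and the gain is at
   most the small drop. *)
exists (2 * n); first by lra.
exists (2 * m1) => [|m mm]; first by lra.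
have m2 : m1 <= m / 2 by lra.
have := hm _ m2; rewrite mulrCA divff// mulr1 => drop.
have n21 : 1 <= 2 * n by lra.
have m21 : 1 <= m by lra.
have [X gX hX] := gmax (2 * n) m n21 m21.
have [Y _ hY] := gmax n (m / 2) n1 (le_trans m11 m2).
have penE z z' : penalty (2 * n) m z z' = 2 * penalty n (m / 2) z z'.
  by rewrite /penalty; field.
have key : th * penalty (2 * n) m X.1.1 X.2 / 2
    + (1 - th) * penalty (2 * n) m X.1.2 X.2 / 2
    <= kap * Num.min th (1 - th) / 2.
  apply: le_trans drop; apply: le_trans (lerB (hY X) (lexx _)).
  by rewrite gX /doubled !penE le_eqVlt; apply/orP; left; apply/eqP; field.
exists X; split; first by move=> Z; rewrite -gX.
- have h1 : th * penalty (2 * n) m X.1.1 X.2 <= kap * th.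
    have h2 : kap * Num.min th (1 - th) <= kap * th.
      by apply: ler_wpM2l; [exact: ltW|rewrite ge_min lexx].
    have h3 : 0 <= (1 - th) * penalty (2 * n) m X.1.2 X.2.
      by rewrite mulr_ge0 ?penalty_ge0//; lra.
    by lra.
  rewrite [leRHS]mulrC ler_pM2l// in h1; apply: le_trans h1.
  by rewrite /penalty lerDl mulr_ge0 ?sqr_ge0//; lra.
- have h1 : (1 - th) * penalty (2 * n) m X.1.2 X.2 <= kap * (1 - th).
    have h2 : kap * Num.min th (1 - th) <= kap * (1 - th).
      by apply: ler_wpM2l; [exact: ltW|rewrite ge_min lexx orbT].
    have h3 : 0 <= th * penalty (2 * n) m X.1.1 X.2.
      by rewrite mulr_ge0 ?penalty_ge0//; lra.
    by lra.
  rewrite [leRHS]mulrC ler_pM2l// in h1; apply: le_trans h1.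
  by rewrite /penalty lerDl mulr_ge0 ?sqr_ge0//; lra.
Qed.

End Doubled.

End Comparison.

Section Comparison.
Context {R : realType}.
Implicit Types (phi u v : R * R -> R) (z : R * R).

Lemma tests_above_global u (Q : R * R -> R -> R -> Prop) phi a b z :
  tests_above u Q -> has_grad phi a b ->
  (forall y, u y - phi y <= u z - phi z) -> Q z (a z) (b z).
Proof.
move=> tu hphi hmax; have [cpsi tpsi xpsi] :=
  C1_has_grad (has_gradD hphi (has_grad_cst (u z - phi z))).
have := tu _ z cpsi; rewrite tpsi xpsi !addr0; apply.
  by rewrite addrC subrK.
by apply/near_normP; exists 1 => // y _; rewrite -lerBlDl.
Qed.

(* Here -w is the super-solution, and A records which time derivatives test
   functions may have (only 0 for stationary functions). *)
Lemma comparison (G : R -> R -> R -> R) (A : R -> Prop) (u1 u2 w : R * R -> R)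
    (B th p1 p2 l1 l2 l l3 : R) :
  ham_continuous G -> Z2_periodic_ham G -> uniformly_coercive G ->
  time_regular G -> usc u1 -> usc u2 -> usc w ->
  (forall z, `|u1 z| <= B) -> (forall z, `|u2 z| <= B) ->
  (forall z, `|w z| <= B) -> Z2_periodic u1 -> Z2_periodic u2 ->
  Z2_periodic w -> 0 < th -> th < 1 ->
  tests_above u1 (fun z a q => A a /\ a + G z.1 z.2 (p1 + q) <= l1) ->
  tests_above u2 (fun z a q => A a /\ a + G z.1 z.2 (p2 + q) <= l2) ->
  vsub (vneg (heqn G 0 l3 (th * p1 + (1 - th) * p2))) w ->
  (forall e t x a1 a2 q1 q2 : R, 0 < e -> A a1 -> A a2 ->
     a1 + G t x q1 <= l1 + e -> a2 + G t x q2 <= l2 + e ->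
     th * a1 + (1 - th) * a2 + G t x (th * q1 + (1 - th) * q2) <= l + e) ->
  l3 <= l.
Proof.
move=> Gc Gp Gco Gt uu1 uu2 uw bu1 bu2 bw pu1 pu2 pw th0 th1 su1 su2 sw comb.
have t1 : 0 < 1 - th by lra.
apply/ler_addgt0Pr => e e0.
have [kap1 kap10 hk1] := freeze_base_point Gc Gp Gco Gt l1 p1 e0.
have [kap2 kap20 hk2] := freeze_base_point Gc Gp Gco Gt l2 p2 e0.
have [|n n1 [m1 m11 hX]] := doubled_small_penalty uu1 uu2 uw bu1 bu2 bw pu1 pu2
    pw th0 th1 (kap := Num.min kap1 kap2).
  by rewrite lt_min kap10.
have [m2 m21 hm2] := hk1 n n1; have [m3 m31 hm3] := hk2 n n1.
pose m := Num.max m1 (Num.max m2 m3).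
have [|[[z1 z2] z3] [/= hmax s1 s2]] := hX m; first by rewrite le_max lexx.
have g1 := penalty_grad n m z3.
have [A1 h1] : A (2 * n * (z1.1 - z3.1)) /\ 2 * n * (z1.1 - z3.1)
    + G z1.1 z1.2 (p1 + 2 * m * (z1.2 - z3.2)) <= l1.
  apply: (tests_above_global su1 g1) => y.
  have := hmax (y, z2, z3); rewrite /doubled /= lerD2r lerD2r.
  by rewrite ler_pM2l.
have [A2 h2] : A (2 * n * (z2.1 - z3.1)) /\ 2 * n * (z2.1 - z3.1)
    + G z2.1 z2.2 (p2 + 2 * m * (z2.2 - z3.2)) <= l2.
  apply: (tests_above_global su2 g1) => y.
  have := hmax (z1, y, z3); rewrite /doubled /= lerD2r lerD2l.
  by rewrite ler_pM2l.
have mm2 : m2 <= m by rewrite /m !le_max lexx orbT.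
have mm3 : m3 <= m by rewrite /m !le_max lexx !orbT.
have s1' : n * (z1.1 - z3.1) ^+ 2 <= kap1.
  by apply: le_trans s1 _; rewrite ge_min lexx.
have s2' : n * (z2.1 - z3.1) ^+ 2 <= kap2.
  by apply: le_trans s2 _; rewrite ge_min lexx orbT.
(* Both sub-solution inequalities are moved to [z3], the base point of the super-solution, where
   [comb] merges them. *)
have k1 := hm2 m z1.1 z1.2 z3.1 z3.2 mm2 s1' h1.
have k2 := hm3 m z2.1 z2.2 z3.1 z3.2 mm3 s2' h2.
apply: le_trans (comb e z3.1 z3.2 _ _ _ _ e0 A1 A2 k1 k2).
have g3 := has_gradD (has_gradZ th (penalty_grad n m z1))
  (has_gradZ (1 - th) (penalty_grad n m z2)).
have tw : tests_above w (fun z a q =>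
    vneg (heqn G 0 l3 (th * p1 + (1 - th) * p2)) z (w z) a q <= 0).
  by move=> phi z cphi tz nz; rewrite tz; exact: sw.
have := tests_above_global (z := z3) tw g3.
rewrite /vneg /heqn mul0r add0r oppr_le0 subr_ge0 => h3.
apply: (le_trans (h3 _)) => [y|].
  have := hmax (z1, z2, y); rewrite /doubled /= !(penaltyC _ _ _ y).
  by rewrite !(penaltyC _ _ _ z3); lra.
rewrite le_eqVlt; apply/orP; left; apply/eqP; congr (_ + G _ _ _); ring.
Qed.

End Comparison.

(** * Ergodic constants *)

Section Limits.
Context {R : realType}.
Implicit Types (phi u v : R * R -> R) (z : R * R)
  (F : R * R -> R -> R -> R -> R).

Lemma vsub_cst F (c : R) : (forall z, F z c 0 0 <= 0) -> vsub F (fun=> c).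
Proof.
move=> Fc phi z cphi tz nz.
have [cc tc xc] := C1_has_grad (@has_grad_cst R c).
have [] := grad_eq_at_touch cc cphi tz nz.
by rewrite tc xc => <- <-; rewrite -tz.
Qed.

Lemma usc_cst (c : R) : usc (fun _ : R * R => c).
Proof. by move=> z e e0; apply/near_normP; exists 1 => // y _; rewrite ltrDl. Qed.

Lemma env_cst (c : R) : env (fun _ : R * R => c) = fun=> c.
Proof. by apply: env_id; [exists (`|c|) | exact: usc_cst]. Qed.

Lemma vsub_addc F u (c : R) : (forall z r r' a q, F z r a q = F z r' a q) ->
  vsub F u -> vsub F (fun z => u z + c).
Proof.
move=> Fr su phi z cphi tz nz.
have [cpsi tpsi xpsi] := C1_has_grad (has_gradD ((has_grad_C1 _).1 cphi)
  (has_grad_cst (- c))).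
have := su _ z cpsi; rewrite tpsi xpsi !addr0 (Fr _ _ (phi z)); apply.
  by rewrite -tz addrK.
by move: nz; apply: filterS => y; rewrite -lerBrDr.
Qed.

(** The given approximations need be neither ordered nor invariant. The supremum [W e] of all
    sub-solutions with slack [e] and bound [C] decreases with [e] and inherits the symmetries of
    [F]. *)
Lemma exact_limit F (C : R) : vcont F ->
  (forall e : R, 0 < e -> exists2 u, (forall z, `|u z| <= C) &
     vsub (fun z r a q => F z r a q - e) (env u)) ->
  exists U, [/\ usc U, forall z, `|U z| <= C, vsub F U &
    forall s, shift_inv s F -> shift_inv s U].
Proof.
move=> cF hF.
pose S e := [set u | (forall z, `|u z| <= C) /\
  vsub (fun z r a q => F z r a q - e) (env u)].
have S0 e : 0 < e -> S e !=set0 by move=> /hF[u uC su]; exists u.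
have Sb e u z : S e u -> `|u z| <= C by move=> [].
have Sub e u z : S e u -> u z <= C.
  by move=> /(Sb e u z); rewrite ler_norml => /andP[].
have Slb e u z : S e u -> - C <= u z.
  by move=> /(Sb e u z); rewrite ler_norml => /andP[].
pose W e := vsup (S e).
have bW e : 0 < e -> bounded_plane (W e).
  by move=> /S0 Se; apply: (@bounded_vsup _ _ C) => // u z; exact: Sb.
have WC e z : 0 < e -> W e z <= C.
  by move=> /S0 Se; apply: vsup_le => // u; exact: Sub.
have CW e z : 0 < e -> - C <= W e z.
  move=> /S0 [u Su]; apply: le_trans (vsup_ge (M := C) _ Su); first exact: Slb Su.
  by move=> v; exact: Sub.
have cFe e : vcont (fun z r a q => F z r a q - e).
  move=> z r a q d d0; have [r' r'0 hr] := cF z r a q d d0; exists r' => //.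
  by move=> z' r1 a' q' h1 h2 h3 h4; rewrite opprB addrA subrK; exact: hr.
have sW e : 0 < e -> vsub (fun z r a q => F z r a q - e) (env (W e)).
  move=> e0; apply: (@vsub_vsup _ _ (S e) C) => //; first exact: S0.
  - by move=> u z; exact: Sb.
  - by move=> u [].
have envW e : 0 < e -> env (W e) = W e.
  move=> e0; apply/funext => z; apply/eqP; rewrite eq_le (env_ge (bW e e0)) andbT.
  (* The envelope of the supremum again belongs to the class, so the supremum is already upper
     semi-continuous. *)
  have Senv : S e (env (W e)).
    split => [y|].
      rewrite ler_norml env_lb ?env_ub//; [exact: bW|by move=> ?; exact: WC| |].
        exact: bW.
      by move=> ?; exact: CW.
    rewrite (env_id (bounded_env (bW e e0)) (usc_env (bW e e0))).
    exact: sW.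
  by apply: (vsup_ge (M := C)) => // u; exact: Sub.
have mW d e z : 0 < d -> d <= e -> W d z <= W e z.
  move=> d0 de; apply: vsup_le; first exact: S0.
  move=> u [uC su]; apply: (vsup_ge (M := C)); first by move=> v; exact: Sub.
  split => // f y cf ty ny; apply: le_trans (su f y cf ty ny).
  by rewrite lerD2l lerN2.
pose U z := inf [set W e z | e in [set e | 0 < e]].
have lbU z : has_lbound [set W e z | e in [set e | 0 < e]].
  by exists (- C) => _ [e /= e0 <-]; exact: CW.
have UW e z : 0 < e -> U z <= W e z by move=> e0; apply: ge_inf => //; exists e.
have U0 z : [set W e z | e in [set e | 0 < e]] !=set0.
  by exists (W 1 z), 1 => //=; exact: ltr01.
have limW z c : U z < c -> exists2 e, 0 < e & W e z < c.
  by move=> /(inf_lt (U0 z))[_ [e /= e0 <-] h]; exists e.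
have uW e : 0 < e -> usc (W e) by move=> e0; rewrite -envW//; exact/usc_env/bW.
exists U; split.
- move=> z e e0; have [|d d0 hd] := limW z (U z + e / 2).
    by rewrite ltrDl divr_gt0.
  have e20 : 0 < e / 2 by rewrite divr_gt0.
  have := uW d d0 z (e / 2) e20; apply: filterS => y.
  by have := UW d y d0; lra.
- move=> z; rewrite ler_norml; apply/andP; split.
    by apply: lb_le_inf => // _ [e /= e0 <-]; exact: CW.
  by apply: le_trans (UW 1 z ltr01) (WC 1 z ltr01).
- apply: (vsub_decreasing_limit cF uW) => //.
  by move=> e e0; rewrite -envW//; exact: sW.
- have Sshift e s u : shift_inv s F -> S e u -> S e (fun y => u (y + s)).
    move=> Fs [uC su]; split => [z|]; first exact: uC.
    have -> : env (fun y => u (y + s)) = (fun y => env u (y + s)).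
      by apply/funext => y; rewrite env_shift.
    by apply: vsub_shift => // z; apply/funext => r; rewrite Fs.
  have le_shift s e z : 0 < e -> shift_inv s F -> W e (z + s) <= W e z.
    move=> e0 Fs; apply: vsup_le; first exact: S0.
    move=> u Su; apply: (@vsup_ge _ (S e) (fun y => u (y + s)) z C).
      by move=> v; exact: Sub.
    exact: Sshift.
  move=> s Fs z; rewrite /U; congr (inf _); apply/seteqP.
  have Weq e : 0 < e -> W e (z + s) = W e z.
    move=> e0; apply/eqP; rewrite eq_le le_shift//=.
    by rewrite -[X in W e X <= _](addrK s z) le_shift//; exact: shift_invN.
  by split=> _ [e /= e0 <-]; exists e => //; rewrite Weq.
Qed.

End Limits.

(** * Correctors and comparison in a common frame *)

Section Structure.
Context {R : realType}.
Implicit Types (phi u v : R * R -> R) (z s : R * R).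

(* Common frame for the two structural cases: Sh is the group of translations
   leaving the equation invariant (all time translations when the Hamiltonian is
   autonomous, integer ones otherwise), A holds of the time derivatives that
   test functions of Sh-invariant functions may have, and mix is the maximum
   under quasi-convexity, the weighted mean under convexity. *)
Record ergodic_structure (G : R -> R -> R -> R) (Sh : set (R * R))
    (A : R -> Prop) (mix : R -> R -> R -> R) : Prop := ErgodicStructure {
  es_int : forall k j : int, Sh (k%:~R, j%:~R);
  es_add : forall s s', Sh s -> Sh s' -> Sh (s + s');
  es_opp : forall s, Sh s -> Sh (- s);
  es_inv : forall s k c p, Sh s -> shift_inv s (heqn G k c p);
  es_tests : forall u, (forall s, Sh s -> shift_inv s u) ->
    tests_above u (fun _ a _ => A a);
  es_bound : forall p, exists2 b0 : R, 0 < b0 & forall c : R,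
    exists2 K : R, 0 <= K & forall a t x q b, A a -> a + G t x (p + q) <= c ->
      `|b| <= b0 -> a + b * q <= K;
  es_comb : forall th l1 l2 e t x a1 a2 q1 q2 : R, 0 < th -> th < 1 ->
    A a1 -> A a2 -> a1 + G t x q1 <= l1 + e -> a2 + G t x q2 <= l2 + e ->
    th * a1 + (1 - th) * a2 + G t x (th * q1 + (1 - th) * q2)
      <= mix th l1 l2 + e;
  es_mix : forall th l : R, mix th l l = l }.

Section Fixed.
Variables (G : R -> R -> R -> R) (Sh : set (R * R)) (A : R -> Prop)
  (mix : R -> R -> R -> R).
Hypotheses (Gc : ham_continuous G) (Gp : Z2_periodic_ham G)
  (Gco : uniformly_coercive G) (Gt : time_regular G)
  (ES : ergodic_structure G Sh A mix).

Definition Sh_periodic u := forall s, Sh s -> shift_inv s u.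

Lemma Sh_periodic_Z2 u : Sh_periodic u -> Z2_periodic u.
Proof. by move=> pu k j t x; rewrite -(pu _ (es_int ES k j) (t, x)). Qed.

Lemma vsub_tests u (c p : R) : Sh_periodic u -> vsub (heqn G 0 c p) u ->
  tests_above u (fun z a q => A a /\ a + G z.1 z.2 (p + q) <= c).
Proof.
move=> pu su phi z cphi tz nz; split; first exact: (es_tests ES pu cphi tz nz).
by have := su phi z cphi tz nz; rewrite /heqn mul0r add0r subr_le0.
Qed.

(** A given corrector may depend on time even when the Hamiltonian does not. The supremum of its
    translates under [Sh] restores the invariance on which [es_tests] relies. *)
Lemma invariant_subsolution u (B c p : R) : (forall z, `|u z| <= B) ->
  vsub (heqn G 0 c p) (env u) ->
  exists U, [/\ usc U, forall z, `|U z| <= B, Sh_periodic U &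
    vsub (heqn G 0 c p) U].
Proof.
move=> uB su; pose S := [set (fun y => u (y + s)) | s in Sh].
have S0 : S !=set0.
  exists (fun y => u (y + (0%:~R, 0%:~R))), (0%:~R, 0%:~R) => //.
  exact: (es_int ES).
have SB v z : S v -> `|v z| <= B by move=> [s _ <-].
have SB' v z : S v -> v z <= B by move=> /SB-/(_ z); rewrite ler_norml => /andP[].
have bS := bounded_vsup S0 SB.
have le_shift s z : Sh s -> vsup S (z + s) <= vsup S z.
  move=> hs; apply: vsup_le => // _ [s' hs' <-].
  rewrite -addrA; apply: (@vsup_ge _ S (fun y => u (y + (s + s'))) z B).
    by move=> v; exact: SB'.
  by exists (s + s') => //; exact: (es_add ES).
exists (env (vsup S)); split.
- exact: usc_env.
- move=> z; rewrite ler_norml; apply/andP; split; last first.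
    by apply: env_ub => // y; apply: vsup_le => // v; exact: SB'.
  apply: env_lb => // y; have [v Sv] := S0.
  apply: (@le_trans _ _ (v y)); last first.
    by apply: (vsup_ge (M := B)) => // w; exact: SB'.
  by have := SB v y Sv; rewrite ler_norml => /andP[].
- move=> s hs z; rewrite -env_shift; congr (env _ z); apply/funext => y.
  apply/eqP; rewrite eq_le le_shift//= -[X in vsup S X <= _](addrK s y).
  by apply: le_shift; exact: (es_opp ES).
- apply: (@vsub_vsup _ _ S B) => //; first exact: vcont_heqn.
  move=> _ [s hs <-].
  have -> : env (fun y => u (y + s)) = (fun y => env u (y + s)).
    by apply/funext => y; rewrite env_shift.
  by apply: vsub_shift => //; exact: (es_inv ES).
Qed.

Lemma ergodic_comparison (u1 u2 w : R * R -> R) (B1 B2 B3 th p1 p2 l1 l2 l3 : R) :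
  0 < th -> th < 1 ->
  (forall z, `|u1 z| <= B1) -> (forall z, `|u2 z| <= B2) ->
  (forall z, `|w z| <= B3) -> usc w -> Z2_periodic w ->
  vsub (heqn G 0 l1 p1) (env u1) -> vsub (heqn G 0 l2 p2) (env u2) ->
  vsub (vneg (heqn G 0 l3 (th * p1 + (1 - th) * p2))) w ->
  l3 <= mix th l1 l2.
Proof.
move=> th0 th1 b1 b2 b3 uw pw s1 s2 sw.
have [U1 [uU1 bU1 pU1 sU1]] := invariant_subsolution b1 s1.
have [U2 [uU2 bU2 pU2 sU2]] := invariant_subsolution b2 s2.
have BB z (f : R * R -> R) (b : R) : (forall z, `|f z| <= b) ->
    b <= Num.max B1 (Num.max B2 B3) -> `|f z| <= Num.max B1 (Num.max B2 B3).
  by move=> fb; exact: le_trans.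
apply: (@comparison _ G A U1 U2 w (Num.max B1 (Num.max B2 B3)) th p1 p2 l1 l2)
  => //.
- by move=> z; apply: BB bU1 _; rewrite !le_max lexx.
- by move=> z; apply: BB bU2 _; rewrite !le_max lexx orbT.
- by move=> z; apply: BB b3 _; rewrite !le_max lexx !orbT.
- exact: Sh_periodic_Z2.
- exact: Sh_periodic_Z2.
- exact: vsub_tests.
- exact: vsub_tests.
- by move=> *; exact: (es_comb ES).
Qed.

(** The same sub-solution is used twice with weight 1/2; [es_mix] then collapses the two
    constants. *)
Lemma ergodic_comparison1 (u w : R * R -> R) (B1 B3 p l l3 : R) :
  (forall z, `|u z| <= B1) -> (forall z, `|w z| <= B3) -> usc w ->
  Z2_periodic w -> vsub (heqn G 0 l p) (env u) ->
  vsub (vneg (heqn G 0 l3 p)) w -> l3 <= l.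
Proof.
move=> b1 b3 uw pw su sw; rewrite -(es_mix ES (1 / 2) l).
apply: (@ergodic_comparison u u w B1 B1 B3 (1 / 2) p p) => //; try lra.
by have -> : 1 / 2 * p + (1 - 1 / 2) * p = p by field.
Qed.

Lemma discounted_solution (p M d : R) : (forall t x, `|G t x p| <= M) -> 0 < d ->
  exists V, [/\ usc V, forall z, `|V z| <= M / d, Sh_periodic V,
    vsub (heqn G d 0 p) V & vsub (vneg (heqn G d 0 p)) (env (fun z => - V z))].
Proof.
move=> GM d0; have cF := @vcont_heqn _ G d 0 p Gc.
have M0 : 0 <= M by apply: le_trans (GM 0 0).
have Md : 0 <= M / d by rewrite divr_ge0// ltW.
have dM : d * (M / d) = M by rewrite mulrCA divff ?gt_eqF// mulr1.
pose u0 (z : R * R) : R := - (M / d); pose w0 (z : R * R) := M / d.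
have u0M z : `|u0 z| <= M / d by rewrite normrN ger0_norm.
have w0M z : `|w0 z| <= M / d by rewrite ger0_norm.
have u0w0 z : u0 z <= w0 z by rewrite /u0 /w0; lra.
have su0 : vsub (heqn G d 0 p) (env u0).
  have -> : env u0 = (fun=> - (M / d)) := env_cst (- (M / d)).
  apply: vsub_cst => z; rewrite /heqn mulrN dM !addr0 subr0 addrC subr_le0.
  exact: le_trans (ler_norm _) (GM _ _).
have sw0 : vsub (vneg (heqn G d 0 p)) (env (fun z => - w0 z)).
  have -> : env (fun z => - w0 z) = (fun=> - (M / d)) := env_cst (- (M / d)).
  apply: vsub_cst => z; rewrite /vneg /heqn opprK dM oppr0 !addr0 oppr_le0.
  have := GM z.1 z.2; rewrite ler_norml => /andP[h _].
  by rewrite addrC -lerBlDr sub0r.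
pose V := vsup (perron_class (heqn G d 0 p) u0 w0).
have bV := bounded_perron u0M w0M u0w0 su0.
have betw := perron_between u0M w0M u0w0 su0.
have sV := perron_sub cF u0M w0M u0w0 su0.
(* The barriers are constant, hence bound [env V] as well; it is thus a member of the class, and [V]
   is upper semi-continuous. *)
have envV : env V = V.
  apply/funext => z; apply/eqP; rewrite eq_le (env_ge bV) andbT.
  apply: (vsup_ge (M := M / d)); first by move=> u [/(_ z)/andP[]].
  split=> [y|]; last by rewrite (env_id (bounded_env bV) (usc_env bV)).
  by rewrite env_lb ?env_ub// => x; have /andP[] := betw x.
exists V; split.
- by rewrite -envV; exact: usc_env.
- by move=> z; rewrite ler_norml; exact: betw.
- by move=> s hs; apply: (perron_shift u0M w0M u0w0 su0) => //; exact: (es_inv ES).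
- by rewrite -envV.
- exact: (perron_super cF u0M w0M u0w0 su0 sw0).
Qed.

Lemma Z2_periodic_env u : Z2_periodic u -> Z2_periodic (env u).
Proof.
move=> pu k j t x.
rewrite -[LHS]/(env u ((t, x) + (k%:~R, j%:~R))) -env_shift.
congr (env _ _); apply/funext => y.
have -> : y + (k%:~R, j%:~R) = (y.1 + k%:~R, y.2 + j%:~R) by [].
by rewrite pu -surjective_pairing.
Qed.

Lemma Z2_periodic_envN u : Z2_periodic u -> Z2_periodic (env (fun z => - u z)).
Proof. by move=> pu; apply: Z2_periodic_env => k j t x; rewrite pu. Qed.

(* V is a discounted solution recentred at 0: its oscillation does not depend on
   the discount. *)
Lemma approximate_correctors p : exists lam C : R, forall e : R, 0 < e ->
  exists V : R * R -> R, [/\ forall z, `|V z| <= C, usc V,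
    vsub (heqn G 0 (lam + e) p) V
  & vsub (vneg (heqn G 0 (lam - e) p)) (env (fun z => - V z))].
Proof.
have [M hM] := ham_bounded Gc Gp `|p|.
have GM t x : `|G t x p| <= M by exact: hM.
have M0 : 0 <= M by apply: le_trans (GM 0 0).
have [b0 b00 /(_ M)[K K0 hK]] := es_bound ES p.
pose C := (K + 1) * (b0^-1 + 1).
have C0 : 0 <= C by rewrite mulr_ge0 ?addr_ge0// invr_ge0 ltW.
have step (d : R) : 0 < d -> exists (l : R) (V : R * R -> R),
    [/\ forall z, `|V z| <= C, usc V,
    Sh_periodic V, vsub (heqn G 0 (l + d * C) p) V
  & vsub (vneg (heqn G 0 (l - d * C) p)) (env (fun z => - V z))].
  move=> d0; have [V [uV VM pV sV wV]] := discounted_solution GM d0.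
  have bV : bounded_plane V by exists (M / d).
  have bNV := bounded_planeN bV.
  have dM : d * (M / d) = M by rewrite mulrCA divff ?gt_eqF// mulr1.
  have osc : forall z z', V z <= V z' + C.
    apply: (oscillation_le uV VM (Sh_periodic_Z2 pV) b00 K0).
    move=> b phi z hb cphi tz nz; have at_ := es_tests ES pV cphi tz nz.
    (* As [d V >= - M], the discounted equation bounds [a + G] by [M], the level for which [K] was
       chosen. *)
    apply: (hK _ z.1 z.2) => //.
    have := sV phi z cphi tz nz; rewrite /heqn subr0 -tz.
    have : d * - (M / d) <= d * V z.
      by rewrite ler_pM2l//; have := VM z; rewrite ler_norml => /andP[].
    by rewrite mulrN dM; lra.
  have dosc z z' : d * V z <= d * V z' + d * C by rewrite -mulrDr ler_pM2l.
  (* The discount term [d V] differs from [d V 0] by at most [d C]; it is frozen at the origin and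
     the difference goes into the constant. *)
  exists (- (d * V 0)), (fun z => V z - V 0); split.
  - move=> z; rewrite ler_norml; apply/andP; split.
      by have := osc 0 z; lra.
    by have := osc z 0; lra.
  - by move=> z e e0; have := uV z e e0; apply: filterS => y; lra.
  - by move=> s hs z; rewrite (pV s hs).
  - apply: vsub_addc => [z r r' a q|]; first by rewrite /heqn !mul0r.
    move=> phi z cphi tz nz; have := sV phi z cphi tz nz.
    by rewrite /heqn -tz => h; have h' := dosc 0 z; lra.
  - have -> : env (fun z => - (V z - V 0)) =
        (fun z => env (fun y => - V y) z + V 0).
      have -> : (fun z => - (V z - V 0)) = (fun z => - V z + V 0).
        by apply/funext => z; rewrite opprB addrC.
      have bc (W : R * R -> R) c : bounded_plane W ->
          bounded_plane (fun z => W z + c).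
        move=> [B hB]; exists (B + `|c|) => z; apply: le_trans (ler_normD _ _) _.
        by rewrite lerD2r.
      have le_addc (W : R * R -> R) c z : bounded_plane W ->
          env (fun z => W z + c) z <= env W z + c.
        move=> bW; apply/ler_addgt0Pr => e e0; apply: env_le; first exact: bc.
        have : \forall y \near z, W y <= env W z + e.
          by apply: env_lt_near => //; lra.
        by apply: filterS => y; lra.
      apply/funext => z; apply/eqP; rewrite eq_le le_addc//=.
      have := le_addc _ (- V 0) z (bc _ (V 0) bNV).
      have -> : (fun z => - V z + V 0 + - V 0) = (fun z => - V z).
        by apply/funext => y; rewrite addrK.
      by rewrite lerBrDr.
    apply: vsub_addc => [z r r' a q|]; first by rewrite /vneg /heqn !mul0r.
    move=> phi z cphi tz nz; have := wV phi z cphi tz nz.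
    have : env (fun y => - V y) z >= - V 0 - C.
      apply: (@le_trans _ _ (- V z)); first by have := osc z 0; lra.
      exact: (env_ge bNV z).
    rewrite -(ler_pM2l d0) tz => h; rewrite /vneg /heqn => h'; lra.
have cmp (d d' l l' : R) (V V' : R * R -> R) : 0 < d -> 0 < d' ->
    (forall z, `|V z| <= C) ->
    (forall z, `|V' z| <= C) -> usc V -> Sh_periodic V' ->
    vsub (heqn G 0 (l + d * C) p) V ->
    vsub (vneg (heqn G 0 (l' - d' * C) p)) (env (fun z => - V' z)) ->
    l' - d' * C <= l + d * C.
  move=> d0 d'0 VC V'C uV pV' sV wV'.
  have bV : bounded_plane V by exists C.
  have bNV' : bounded_plane (fun z => - V' z) by exists C => z; rewrite normrN.
  have [B hB] := bounded_env bNV'.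
  apply: (@ergodic_comparison1 V (env (fun z => - V' z)) C B p) => //.
  - exact: usc_env.
  - exact/Z2_periodic_envN/Sh_periodic_Z2.
  - by rewrite env_id.
(* By comparison every lower constant [l - d C] is below every upper constant [l' + d' C]; the
   supremum of the lower ones separates them. *)
pose L := [set x : R | exists (d l : R) (V : R * R -> R), [/\ 0 < d, x = l - d * C &
  [/\ forall z, `|V z| <= C, usc V, Sh_periodic V, vsub (heqn G 0 (l + d * C) p) V
  & vsub (vneg (heqn G 0 (l - d * C) p)) (env (fun z => - V z))]]].
have Lub (d l : R) (V : R * R -> R) : 0 < d -> (forall z, `|V z| <= C) -> usc V ->
    vsub (heqn G 0 (l + d * C) p) V -> ubound L (l + d * C).
  move=> d0 VC uV sV _ [d' [l' [V' [d'0 -> [V'C _ pV' _ wV']]]]].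
  exact: (cmp d d' l l' V V').
have L0 : L !=set0.
  have [l [V hV]] := step 1 ltr01; exists (l - 1 * C), 1, l, V; split.
  - exact: ltr01.
  - by [].
  - exact: hV.
exists (sup L), C => e e0.
(* Lower and upper constants differ by [2 d C <= e]; the added 1 avoids dividing by zero. *)
pose d := e / (2 * C + 1).
have C1 : 0 < 2 * C + 1 by lra.
have d0 : 0 < d by rewrite divr_gt0.
have de : d * (2 * C) <= e.
  have <- : d * (2 * C + 1) = e by rewrite /d divfK ?gt_eqF.
  by rewrite ler_pM2l// lerDl.
have [l [V [VC uV pV sV wV]]] := step d d0.
have le1 : sup L <= l + d * C by apply: ge_sup => //; exact: Lub VC uV sV.
have le2 : l - d * C <= sup L.
  apply: ub_le_sup; first by exists (l + d * C); exact: Lub VC uV sV.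
  by exists d, l, V; split.
exists V; split => //.
- move=> phi z cphi tz nz; have := sV phi z cphi tz nz.
  by rewrite /heqn; lra.
- move=> phi z cphi tz nz; have := wV phi z cphi tz nz.
  by rewrite /vneg /heqn; lra.
Qed.

Lemma ergodic_constant_exists p : exists lam, ergodic_constant G p lam.
Proof.
have [lam [C hC]] := approximate_correctors p.
have cF := @vcont_heqn _ G 0 lam p Gc.
have Fe e : (fun z r a q => heqn G 0 lam p z r a q - e) = heqn G 0 (lam + e) p.
  apply/funext => z; apply/funext => r; apply/funext => a; apply/funext => q.
  by rewrite /heqn opprD addrA.
have Ne e : (fun z r a q => vneg (heqn G 0 lam p) z r a q - e) =
    vneg (heqn G 0 (lam - e) p).
  apply/funext => z; apply/funext => r; apply/funext => a; apply/funext => q.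
  by rewrite /vneg /heqn; ring.
have [U [uU UC sU iU]] : exists U, [/\ usc U, forall z, `|U z| <= C,
    vsub (heqn G 0 lam p) U &
    forall s, shift_inv s (heqn G 0 lam p) -> shift_inv s U].
  apply: exact_limit => // e e0; have [V [VC uV sV _]] := hC e e0.
  by exists V => //; rewrite Fe env_id//; exists C.
have [N [uN NC sN iN]] : exists N, [/\ usc N, forall z, `|N z| <= C,
    vsub (vneg (heqn G 0 lam p)) N &
    forall s, shift_inv s (vneg (heqn G 0 lam p)) -> shift_inv s N].
  apply: exact_limit; first exact: vcont_neg.
  move=> e e0; have [V [VC uV _ wV]] := hC e e0.
  by exists (fun z => - V z); [move=> z; rewrite normrN|rewrite Ne].
(* Without discount, adding a constant preserves super-solutions; [2 C] lifts [- N] above [U]. *)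
pose w0 z : R := - N z + 2 * C.
have C0 : 0 <= C by apply: le_trans (UC 0).
have NC' z : - C <= N z <= C by rewrite -ler_norml.
have UC' z : - C <= U z <= C by rewrite -ler_norml.
have u0M z : `|U z| <= 3 * C by apply: le_trans (UC z) _; lra.
have w0M z : `|w0 z| <= 3 * C.
  by have /andP[? ?] := NC' z; rewrite /w0 ler_norml; apply/andP; split; lra.
have u0w0 z : U z <= w0 z.
  by have /andP[? ?] := NC' z; have /andP[? ?] := UC' z; rewrite /w0; lra.
have bU : bounded_plane U by exists C.
have su0 : vsub (heqn G 0 lam p) (env U) by rewrite env_id.
have sw0 : vsub (vneg (heqn G 0 lam p)) (env (fun z => - w0 z)).
  have -> : (fun z => - w0 z) = (fun z => N z + - (2 * C)).
    by apply/funext => z; rewrite /w0 opprD opprK.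
  rewrite env_id.
  - by apply: vsub_addc => // z r r' a q; rewrite /vneg /heqn !mul0r.
  - exists (3 * C) => z; have /andP[? ?] := NC' z.
    by rewrite ler_norml; apply/andP; split; lra.
  - by move=> z e e0; have := uN z e e0; apply: filterS => y; lra.
exists lam, (vsup (perron_class (heqn G 0 lam p) U w0)).
have bv := bounded_perron u0M w0M u0w0 su0.
split => //.
  split.
    apply/visc_subsolutionE => //.
    exact: (perron_sub cF u0M w0M u0w0 su0).
  apply/visc_supersolutionE => //.
  exact: (perron_super cF u0M w0M u0w0 su0 sw0).
apply: Sh_periodic_Z2 => s hs.
have Fs := es_inv ES 0 lam p hs.
apply: (perron_shift u0M w0M u0w0 su0) => //; first exact: iU.
move=> z; rewrite /w0 iN// => y.
by apply/funext => r; apply/funext => a; apply/funext => q; rewrite /vneg Fs.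
Qed.

Lemma ergodic_constant_le p l l' : ergodic_constant G p l ->
  ergodic_constant G p l' -> l' <= l.
Proof.
move=> [v [[B hB] [sv _] _]] [w [[B' hB'] [_ sw] pw]].
have bv : bounded_plane v by exists B.
have bw : bounded_plane w by exists B'.
have bNw := bounded_planeN bw; have [B'' hB''] := bounded_env bNw.
apply: (@ergodic_comparison1 v (env (fun z => - w z)) B B'' p) => //.
- exact: usc_env.
- exact: Z2_periodic_envN.
- exact/visc_subsolutionE.
- exact/visc_supersolutionE.
Qed.

Lemma ergodic_constant_unique p l l' : ergodic_constant G p l ->
  ergodic_constant G p l' -> l = l'.
Proof. by move=> h h'; apply/eqP; rewrite eq_le !(@ergodic_constant_le p). Qed.

Lemma ergodic_constant_mix th p1 p2 l1 l2 l3 : 0 < th -> th < 1 ->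
  ergodic_constant G p1 l1 -> ergodic_constant G p2 l2 ->
  ergodic_constant G (th * p1 + (1 - th) * p2) l3 -> l3 <= mix th l1 l2.
Proof.
move=> th0 th1 [v1 [bv1 [sv1 _] _]] [v2 [bv2 [sv2 _] _]] [w [bw [_ sw] pw]].
have [B1 hB1] := bv1; have [B2 hB2] := bv2.
have bNw := bounded_planeN bw; have [B3 hB3] := bounded_env bNw.
apply: (@ergodic_comparison v1 v2 (env (fun z => - w z)) B1 B2 B3 th p1 p2) => //.
- exact: usc_env.
- exact: Z2_periodic_envN.
- exact/visc_subsolutionE.
- exact/visc_subsolutionE.
- exact/visc_supersolutionE.
Qed.

End Fixed.
End Structure.

(** * The two structural hypotheses *)

Section Instances.
Context {R : realType}.
Variable G : R -> R -> R -> R.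
Hypotheses (Gc : ham_continuous G) (Gp : Z2_periodic_ham G)
  (Gco : uniformly_coercive G).

Definition quasi_shifts : set (R * R) := [set s | exists j : int, s.2 = j%:~R].

Definition convex_shifts : set (R * R) :=
  [set s | exists k j : int, s = (k%:~R, j%:~R)].

Lemma ham_continuous_snd (t x p e : R) : 0 < e ->
  exists2 d : R, 0 < d & forall q : R, `|q - p| < d -> `|G t x q - G t x p| < e.
Proof.
move=> e0; have [d d0 hd] := ham_continuousP Gc t x p e0.
by exists d => // q hq; apply: hd; rewrite ?subrr ?normr0.
Qed.

Lemma coercive_bound (c : R) : exists2 K : R, 0 <= K &
  forall t x q, G t x q <= c -> `|q| <= K.
Proof.
have [K hK] := Gco (c + 1).
exists (Num.max 0 K) => [|t x q Gq]; first by rewrite le_max lexx.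
rewrite leNgt gt_max; apply/negP => /andP[_ /ltW /hK/(_ t x)].
by lra.
Qed.

(** Monotonicity is assumed strictly to the left and to the right of [p0] only, so the case [r = p0]
    goes through continuity, approaching [r] from the left. *)
Lemma quasiconvex_between (t x p0 p q r : R) :
  nonincreasing_left_of p0 (G t x) -> nondecreasing_right_of p0 (G t x) ->
  p <= r -> r <= q -> G t x r <= Num.max (G t x p) (G t x q).
Proof.
move=> dec inc pr rq; rewrite le_max.
have [rp0|p0r|rp0] := ltgtP r p0; first by rewrite dec.
  by rewrite (inc _ _ p0r rq) orbT.
have [<-|pr'] := eqVneq p r; first by rewrite lexx.
have ltpr : p < r by rewrite lt_neqAle pr'.
suff -> : G t x r <= G t x p by [].
apply/ler_addgt0Pr => e e0; have [d d0 hd] := ham_continuous_snd t x r e0.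
pose s := Num.max p (r - d / 2).
have sr : s < r by rewrite gt_max ltpr gtrBl divr_gt0.
have ps : p <= s by rewrite le_max lexx.
have sd : r - d / 2 <= s by rewrite le_max lexx orbT.
have := hd s; rewrite !ltr_norml => h.
have /andP[h1 _] : - e < G t x s - G t x r < e.
  by apply: h; apply/andP; split; lra.
have h2 : G t x s <= G t x p by apply: dec => //; rewrite -rp0.
lra.
Qed.

Lemma quasiconvex_structure : autonomous_quasiconvex G ->
  ergodic_structure G quasi_shifts (fun a => a = 0)
    (fun _ l1 l2 => Num.max l1 l2).
Proof.
move=> [Ga [p0 Gq]].
have Gmax t x (th q1 q2 : R) : 0 < th -> th < 1 ->
    G t x (th * q1 + (1 - th) * q2) <= Num.max (G t x q1) (G t x q2).
  move=> th0 th1; have [dec inc] := Gq t x.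
  have [q12|q21] := leP q1 q2.
    have h1 : 0 <= th * (q2 - q1) by rewrite mulr_ge0 ?subr_ge0// ltW.
    have h2 : 0 <= (1 - th) * (q2 - q1) by rewrite mulr_ge0 ?subr_ge0// ltW.
    by apply: (quasiconvex_between dec inc); lra.
  have h1 : 0 <= th * (q1 - q2) by rewrite mulr_ge0 ?subr_ge0// ltW.
  have h2 : 0 <= (1 - th) * (q1 - q2) by rewrite mulr_ge0 ?subr_ge0// ltW.
  by rewrite maxC; apply: (quasiconvex_between dec inc); lra.
split.
- by move=> k j; exists j.
- by move=> s s' [j hj] [j' hj']; exists (j + j'); rewrite /= hj hj' intrD.
- by move=> s [j hj]; exists (- j); rewrite /= hj mulrNz.
- move=> s k c p [j hj] z; apply/funext => r; apply/funext => a; apply/funext => q.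
  by rewrite /heqn /= hj (Ga _ z.1) -[X in G X _ _]addr0 (Gp 0 j).
- move=> u pu phi z cphi tz nz; have [dphi _ _] := cphi.
  (* Along the time axis [u] is constant, so [phi] has a minimum there at [z]; both directions
     together give a zero derivative. *)
  have along (c : R) : 0 <= 'D_((c, 0) : R * R) phi z.
    apply: derive_ge0_along => //; have := near_along (c, 0) nz.
    apply: filterS => k; rewrite -tz; apply: le_trans.
    have hk : quasi_shifts (k *: ((c, 0) : R * R)).
      by exists 0; rewrite /= scaler0.
    by rewrite addrC (pu _ hk).
  apply/eqP; rewrite eq_le along andbT.
  have := along (-1); rewrite !deriveE//.
  have -> : ((-1, 0) : R * R) = - (1, 0) by rewrite -[RHS]/(-1, -0) oppr0.
  by rewrite linearN oppr_ge0 /dt deriveE.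
- move=> p; exists 1 => // c; have [K K0 hK] := coercive_bound c.
  exists (K + `|p|) => [|a t x q b -> h b1]; first by rewrite addr_ge0.
  rewrite add0r in h; rewrite add0r; apply: le_trans (ler_norm _) _; rewrite normrM.
  apply: (@le_trans _ _ `|q|); first by rewrite ler_piMl.
  have -> : q = (p + q) - p by rewrite addrAC subrr add0r.
  by apply: le_trans (ler_normB _ _) _; rewrite lerD2r; exact: hK h.
- move=> th l1 l2 e t x a1 a2 q1 q2 th0 th1 -> ->; rewrite !add0r !mulr0 addr0.
  move=> h1 h2; rewrite add0r; apply: le_trans (Gmax _ _ _ _ _ th0 th1) _.
  have m1 : l1 <= Num.max l1 l2 by rewrite le_max lexx.
  have m2 : l2 <= Num.max l1 l2 by rewrite le_max lexx orbT.
  by rewrite ge_max; apply/andP; split; lra.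
- by move=> th l; rewrite maxxx.
Qed.

Lemma convex_gradientP (th t x q1 q2 : R) : convex_in_gradient G ->
  0 <= th -> th <= 1 ->
  G t x (th * q1 + (1 - th) * q2) <= th * G t x q1 + (1 - th) * G t x q2.
Proof.
move=> cG th0 th1.
by have := cG t x (Itv01 th0 th1) q1 q2; apply; rewrite inE.
Qed.

(** At radius [K] the value exceeds the bound [M] on the values at 0 by at least 1; convexity along
    the segment from 0 to [q] propagates the slope [1 / K] outwards. *)
Lemma convex_linear_growth : convex_in_gradient G ->
  exists2 K : R, 0 < K & exists C : R, forall t x q : R,
    `|q| / K <= G t x q + C.
Proof.
move=> cG; have [M hM] := ham_bounded Gc Gp 0.
have M0 t x : `|G t x 0| <= M by apply: hM; rewrite normr0.
have Mge0 : 0 <= M by apply: le_trans (M0 0 0).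
have [K0 hK0] := Gco (M + 1).
pose K := Num.max 1 K0.
have K1 : 1 <= K by rewrite le_max lexx.
have K0K : K0 <= K by rewrite le_max lexx orbT.
have Kp : 0 < K by lra.
have [MK hMK] := ham_bounded Gc Gp K.
exists K => //; exists (1 + `|MK|) => t x q.
have [qK|Kq] := leP `|q| K.
  have h1 : `|q| / K <= 1 by rewrite ler_pdivrMr// mul1r.
  have := hMK t x q qK; rewrite ler_norml => /andP[h2 _].
  have h3 := ler_norm MK; lra.
have q0 : 0 < `|q| by lra.
pose s := K / `|q|.
have s0 : 0 < s by rewrite divr_gt0.
have s1 : s <= 1 by rewrite ler_pdivrMr// mul1r ltW.
have sq : `|s * q| = K by rewrite normrM gtr0_norm// divfK ?gt_eqF.
have h1 : M + 1 <= G t x (s * q) by apply: hK0; rewrite sq.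
have := convex_gradientP t x q 0 cG (ltW s0) s1.
rewrite mulr0 addr0 => h2.
have h3 : (1 - s) * G t x 0 <= (1 - s) * M.
  by rewrite ler_wpM2l ?subr_ge0//; apply: le_trans (ler_norm _) (M0 _ _).
have h4 : 1 <= s * G t x q.
  have : 0 <= s * M by rewrite mulr_ge0// ltW.
  lra.
have h5 : `|q| / K <= G t x q.
  have -> : `|q| / K = s^-1 by rewrite invf_div.
  by rewrite -(ler_pM2l s0) divff ?gt_eqF.
have := normr_ge0 MK; lra.
Qed.

Lemma convex_structure : convex_in_gradient G ->
  ergodic_structure G convex_shifts (fun=> True)
    (fun th l1 l2 => th * l1 + (1 - th) * l2).
Proof.
move=> cG; split.
- by move=> k j; exists k, j.
- move=> _ _ [k [j ->]] [k' [j' ->]]; exists (k + k'), (j + j').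
  by rewrite !intrD.
- by move=> _ [k [j ->]]; exists (- k), (- j); rewrite !mulrNz.
- move=> _ k0 c p [k [j ->]] z.
  apply/funext => r; apply/funext => a; apply/funext => q.
  by rewrite /heqn /= Gp.
- by [].
- move=> p; have [K K0 [C hC]] := convex_linear_growth cG.
  (* For [|b| <= 1 / K] the linear growth of [G] absorbs [b q], up to the correction [|p| / K]. *)
  exists K^-1; first by rewrite invr_gt0.
  move=> c; exists (Num.max 0 (c + C + `|p| / K)); first by rewrite le_max lexx.
  move=> a t x q b _ h bK; rewrite le_max; apply/orP; right.
  have h1 : b * q <= `|q| / K.
    apply: le_trans (ler_norm _) _; rewrite normrM mulrC.
    by rewrite ler_wpM2l.
  have h2 : `|q| / K <= `|p + q| / K + `|p| / K.
    rewrite -mulrDl ler_pM2r ?invr_gt0//.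
    have -> : `|q| = `|(p + q) - p| by rewrite addrAC subrr add0r.
    exact: ler_normB.
  have h3 := hC t x (p + q); lra.
- move=> th l1 l2 e t x a1 a2 q1 q2 th0 th1 _ _ h1 h2.
  have h3 := convex_gradientP t x q1 q2 cG (ltW th0) (ltW th1).
  have h4 : th * (a1 + G t x q1) <= th * (l1 + e) by rewrite ler_pM2l.
  have h5 : (1 - th) * (a2 + G t x q2) <= (1 - th) * (l2 + e).
    by rewrite ler_pM2l// subr_gt0.
  lra.
- by move=> th l; ring.
Qed.

End Instances.

(** * The effective Hamiltonian *)

Section Effective.
Context {R : realType}.
Implicit Types (u : R * R -> R) (F : R * R -> R -> R -> R -> R).

(** A constant is an admissible test at a global maximum. This bounds the effective Hamiltonian on
    both sides by values of [G] at the same [p]. *)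
Lemma vsub_at_max F u : vsub F u -> usc u -> Z2_periodic u ->
  exists z, F z (u z) 0 0 <= 0.
Proof.
move=> su uu pu.
have [|z _ hz] := usc_max uu (@compact_cball R 0 1).
  by exists 0; rewrite /= subrr normr0.
exists z; have [cc tc xc] := C1_has_grad (@has_grad_cst R (u z)).
have := su _ z cc; rewrite tc xc; apply => //.
apply/near_normP; exists 1 => // y _.
have [k /andP[k0 k1]] := int_shift y.1; have [j /andP[j0 j1]] := int_shift y.2.
have := hz (y.1 + k%:~R, y.2 + j%:~R); rewrite pu -surjective_pairing; apply.
by rewrite /= subr0 norm_pair_le /= (ger0_norm k0) (ger0_norm j0) !ltW.
Qed.

Lemma ergodic_constant_ge G p l : ergodic_constant G p l ->
  exists t x : R, G t x p <= l.
Proof.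
move=> [v [bv [sv _] pv]].
have [z] := vsub_at_max ((visc_subsolutionE _ _ _ bv).1 sv) (usc_env bv)
  (Z2_periodic_env pv).
by rewrite /heqn mul0r !addr0 add0r subr_le0 => h; exists z.1, z.2.
Qed.

Lemma ergodic_constant_le_max G p l : ergodic_constant G p l ->
  exists t x : R, l <= G t x p.
Proof.
move=> [v [bv [_ sv] pv]].
have [z] := vsub_at_max ((visc_supersolutionE _ _ _ bv).1 sv)
  (usc_env (bounded_planeN bv)) (Z2_periodic_envN pv).
rewrite /vneg /heqn oppr0 mul0r !addr0 add0r oppr_le0 subr_ge0 => h.
by exists z.1, z.2.
Qed.

(** Write [q = p + mu h] with [|h| <= 1]: [q] lies between [p] and [p + h], and [p] between [p - h]
    and [q]. Convexity then bounds [|f q - f p|] by [2 mu M]. *)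
Lemma convex_bounded_continuous (f : R -> R) :
  (forall L : R, exists M : R, forall q : R, `|q| <= L -> `|f q| <= M) ->
  (forall th p q : R, 0 < th -> th < 1 ->
     f (th * p + (1 - th) * q) <= th * f p + (1 - th) * f q) ->
  continuous f.
Proof.
move=> fb fc p; apply/cvgrPdist_lt => e e0.
have [M hM] := fb (`|p| + 1).
have fp : `|f p| <= M by apply: hM; rewrite lerDl.
have M0 : 0 <= M by apply: le_trans fp.
pose mu := Num.min (1 / 2) (e / (4 * (M + 1))).
have M1 : 0 < 4 * (M + 1) by lra.
have mu0 : 0 < mu by rewrite lt_min !divr_gt0//; lra.
have mu1 : mu < 1 by apply: (@le_lt_trans _ _ (1 / 2)); [rewrite ge_min lexx|lra].
have mue : mu * (4 * (M + 1)) <= e.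
  by rewrite -ler_pdivlMr// ge_min lexx orbT.
have muM : mu * f p >= - (mu * M).
  by rewrite -mulrN ler_pM2l//; have := fp; rewrite ler_norml => /andP[].
have muM0 : 0 <= mu * M by rewrite mulr_ge0// ltW.
apply/nbhs_normP; exists mu => // q /=; rewrite distrC => hq.
pose h := (q - p) / mu.
have h1 : `|h| <= 1.
  by rewrite normrM normfV (gtr0_norm mu0) ler_pdivrMr// mul1r ltW.
have hmu : mu * h = q - p by rewrite /h mulrC divfK ?gt_eqF.
have bnd (s : R) : `|s| <= 1 -> mu * f (p + s) <= mu * M.
  move=> s1; rewrite ler_pM2l//; apply: le_trans (ler_norm _) (hM _ _).
  by apply: le_trans (ler_normD _ _) _; rewrite lerD2l.
have up : f q <= (1 - mu) * f p + mu * f (p + h).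
  have -> : q = (1 - mu) * p + (1 - (1 - mu)) * (p + h).
    have -> : (1 - mu) * p + (1 - (1 - mu)) * (p + h) = p + mu * h by ring.
    by rewrite hmu; ring.
  have := fc (1 - mu) p (p + h); rewrite gtrBl mu0 subr_gt0 mu1 => /(_ isT isT).
  by rewrite (_ : 1 - (1 - mu) = mu)//; ring.
have down : (1 + mu) * f p <= f q + mu * f (p - h).
  have mu2 : 0 < 1 + mu by lra.
  pose th := (1 + mu)^-1.
  have th0 : 0 < th by rewrite invr_gt0.
  have th1 : th < 1 by rewrite invf_lt1//; lra.
  have thE : (1 + mu) * th = 1 by rewrite divff// gt_eqF.
  have thE' : (1 + mu) * (1 - th) = mu by rewrite mulrBr thE; ring.
  have pE : p = th * q + (1 - th) * (p - h).
    apply: (mulfI (lt0r_neq0 mu2)); rewrite mulrDr !mulrA thE thE' mulrBr hmu.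
    by ring.
  rewrite {1}pE.
  apply: (@le_trans _ _ ((1 + mu) * (th * f q + (1 - th) * f (p - h)))).
    by rewrite ler_pM2l//; exact: fc.
  by rewrite mulrDr !mulrA thE thE' mul1r.
have bh := bnd h h1.
have bh' : mu * f (p - h) <= mu * M by apply: bnd; rewrite normrN.
rewrite ltr_norml; apply/andP; split; lra.
Qed.

Section Structured.
Variables (G : R -> R -> R -> R) (Sh : set (R * R)) (A : R -> Prop)
  (mix : R -> R -> R -> R).
Hypotheses (Gc : ham_continuous G) (Gp : Z2_periodic_ham G)
  (Gco : uniformly_coercive G) (Gt : time_regular G)
  (ES : ergodic_structure G Sh A mix).
Variable Hbar : R -> R.
Hypothesis hH : forall p, ergodic_constant G p (Hbar p).

Lemma effective_bounded (L : R) :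
  exists M : R, forall q : R, `|q| <= L -> `|Hbar q| <= M.
Proof.
have [M hM] := ham_bounded Gc Gp L; exists M => q qL.
have [t [x h1]] := ergodic_constant_ge (hH q).
have [t' [x' h2]] := ergodic_constant_le_max (hH q).
have := hM t x q qL; have := hM t' x' q qL; rewrite !ler_norml.
by move=> /andP[_ h3] /andP[h4 _]; apply/andP; split; lra.
Qed.

Lemma effective_coercive : coercive Hbar.
Proof.
have key M : exists K : R, forall q, K <= `|q| -> M <= Hbar q.
  have [K hK] := Gco M; exists K => q Kq.
  have [t [x h]] := ergodic_constant_ge (hH q).
  exact: le_trans (hK q Kq t x) h.
split; apply/cvgryPge => M; have [K hK] := key M.
  near=> q; apply: hK; apply: le_trans (ler_norm _); near: q.
  by apply: nbhs_pinfty_ge; exact: num_real.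
near=> q; apply: hK; rewrite -normrN; apply: le_trans (ler_norm _).
by rewrite lerNr; near: q; apply: nbhs_ninfty_le; exact: num_real.
Unshelve. all: by end_near. Qed.

Lemma effective_mix th p q : 0 < th -> th < 1 ->
  Hbar (th * p + (1 - th) * q) <= mix th (Hbar p) (Hbar q).
Proof.
by move=> th0 th1; apply: (ergodic_constant_mix Gc Gp Gco Gt ES th0 th1).
Qed.

Lemma effective_quasi_convex :
  (forall th l1 l2, 0 < th -> th < 1 -> mix th l1 l2 <= Num.max l1 l2) ->
  quasi_convex Hbar.
Proof.
move=> hmix lam; apply/convex_setW => p q; rewrite !inE /= => hp hq k k0 k1.
rewrite inE /=; apply: le_trans (effective_mix p q k0 k1) _.
by apply: le_trans (hmix _ _ _ k0 k1) _; rewrite ge_max hp hq.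
Qed.

End Structured.

Section Continuity.
Variables (G : R -> R -> R -> R) (Hbar : R -> R).
Hypotheses (Gc : ham_continuous G) (Gp : Z2_periodic_ham G)
  (Gco : uniformly_coercive G) (Gt : time_regular G)
  (hH : forall p, ergodic_constant G p (Hbar p)).

Lemma convex_effective_continuous : convex_in_gradient G -> continuous Hbar.
Proof.
move=> cG; have ES := convex_structure Gc Gp Gco cG.
apply: convex_bounded_continuous; first exact: effective_bounded.
by move=> th p q th0 th1; apply: (effective_mix Gc Gp Gco Gt ES).
Qed.

(* Stationary sub-solutions have bounded gradients, hence stay approximate
   sub-solutions when p is moved slightly. *)
Lemma quasiconvex_effective_continuous :
  autonomous_quasiconvex G -> continuous Hbar.
Proof.
move=> qG; have ES := quasiconvex_structure Gc Gp Gco qG.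
have transfer (L e : R) : 0 < e -> exists2 d : R, 0 < d & forall p p' : R,
    `|p' - p| < d -> Hbar p <= L -> Hbar p' <= Hbar p + e.
  move=> e0; have [K K0 hK] := coercive_bound Gco L.
  have [d d0 hd] := ham_unif_continuous Gc Gp K e0.
  exists d => // p p' pp' pL.
  have [v [[B hB] [sv _] pv]] := hH p; have [w [bw [_ sw] pw]] := hH p'.
  have bv : bounded_plane v by exists B.
  (* For the stationary [U] tests have zero time derivative, so [G <= Hbar p <= L] and coercivity
     bounds the momentum by [K], uniformly in [p]. *)
  have [U [uU UB pU sU]] := invariant_subsolution Gc ES hB
    ((visc_subsolutionE _ _ _ bv).1 sv).
  have bU : bounded_plane U by exists B.
  have bNw := bounded_planeN bw; have [B' hB'] := bounded_env bNw.
  apply: (ergodic_comparison1 (p := p') Gc Gp Gco Gt ES UB hB' (usc_env bNw)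
    (Z2_periodic_envN pw)); last exact/visc_supersolutionE.
  rewrite env_id// => phi z cphi tz nz.
  have [a0 hG] := vsub_tests ES pU sU cphi tz nz.
  rewrite a0 add0r in hG; rewrite /heqn mul0r add0r a0 add0r.
  have := hd z.1 z.2 _ z.2 (p' + dx phi z) (hK _ _ _ (le_trans hG pL)).
  rewrite subrr normr0 d0 => /(_ isT).
  rewrite (_ : p' + dx phi z - (p + dx phi z) = p' - p); last by ring.
  by move=> /(_ pp'); rewrite ltr_norml => /andP[_ h]; lra.
move=> p; apply/cvgrPdist_lt => e e0.
have [M hM] := effective_bounded Gc Gp hH (`|p| + 1).
have [d d0 hd] := transfer M (e / 2) ltac:(lra).
have HM q : `|q| <= `|p| + 1 -> Hbar q <= M.
  by move=> /hM; exact: le_trans (ler_norm _).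
apply/nbhs_normP; exists (Num.min 1 d) => /=; first by rewrite lt_min ltr01.
move=> q /=; rewrite lt_min => /andP[q1 qd].
have qp : `|q| <= `|p| + 1.
  have -> : q = p - (p - q) by ring.
  by apply: le_trans (ler_normB _ _) _; rewrite lerD2l ltW.
have pp : `|p| <= `|p| + 1 by rewrite lerDl.
have h1 := hd q p qd (HM q qp).
rewrite distrC in qd; have h2 := hd p q qd (HM p pp).
rewrite ltr_norml; apply/andP; split; lra.
Qed.

End Continuity.
End Effective.

(** * Properties inherited by the limits at infinity *)

Section Inheritance.
Context {R : realType}.
Variables (H : R -> R -> R -> R) (Ha : side -> R -> R -> R -> R).
Hypotheses (H_cont : ham_continuous H) (H_per : time_periodic H)
  (H_time : time_regular H) (H_coer : uniformly_coercive H)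
  (H_asym : asymptotically_periodic H Ha).
Variable a : side.

Lemma limit_periodic : Z2_periodic_ham (Ha a).
Proof. by case: H_asym => _ _ per k j t x p; exact: per. Qed.

(** One integer [k] must serve all [x] near [x0], so that continuity can be transferred. The
    convergence is given on the unit cell, hence it is applied with the shift [k + floor x]. *)
Lemma limit_approx (e x0 : R) : 0 < e -> exists k : int, forall t x p : R,
  `|x - x0| < 1 -> `|H t (x + k%:~R) p - Ha a t x p| < e.
Proof.
move=> e0.
have close (k : int) (t x p : R) :
    close_after_shift H (Ha a) (k + Num.floor x) e ->
    `|H t (x + k%:~R) p - Ha a t x p| < e.
  have [m /andP[m0 m1]] := int_shift t.
  have /andP[f0 f1] := floor_itv x; rewrite intrD1 in f1.
  move=> /(_ (t + m%:~R) (x - (Num.floor x)%:~R) p).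
  rewrite m0 (ltW m1) subr_ge0 f0 lerBlDl (ltW f1) => /(_ isT isT).
  rewrite H_per intrD [_%:~R + _ in X in X -> _]addrC addrA subrK.
  by have := limit_periodic m (- Num.floor x) t x p; rewrite mulrNz => ->.
have [left right _] := H_asym.
case: a close left right => close left right.
  (* For [x] within 1 of [x0], [floor x <= floor (x0 + 1)], so the total shift stays at most [K];
     the right side is symmetric. *)
  have [K hK] := left e e0; exists (K - Num.floor (x0 + 1)) => t x p xx0.
  apply: close; apply: hK; rewrite -addrA gerDl addrC subr_le0.
  by apply: le_floor; move: xx0; rewrite ltr_norml => /andP[_ ?]; lra.
have [K hK] := right e e0; exists (K - Num.floor (x0 - 1)) => t x p xx0.
apply: close; apply: hK; rewrite -addrA lerDl addrC subr_ge0.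
by apply: le_floor; move: xx0; rewrite ltr_norml => /andP[? _]; lra.
Qed.

Lemma limit_continuous : ham_continuous (Ha a).
Proof.
move=> [[t x] p]; apply/cvgrPdist_lt => e e0.
have e40 : 0 < e / 4 by lra.
have [k hk] := limit_approx x e40.
have [d d0 hd] := ham_continuousP H_cont t (x + k%:~R) p e40.
have : \forall y \near (t, x, p), ball (t, x, p) (Num.min 1 d) y.
  by apply: nbhsx_ballx; rewrite lt_min ltr01.
apply: filterS => -[[t' x'] p'] [[/=]]; rewrite -!ball_normE /= !lt_min.
move=> /andP[_ td] /andP[x1 xd] /andP[_ pd].
rewrite distrC in td; rewrite distrC in x1; rewrite distrC in xd.
rewrite distrC in pd.
have h1 := hk t' x' p' x1.
have h2 := hk t x p; rewrite subrr normr0 ltr01 in h2; have {}h2 := h2 isT.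
have h3 := hd t' (x' + k%:~R) p' td; rewrite opprD addrACA subrr addr0 in h3.
have {}h3 := h3 xd pd.
move: h1 h2 h3; rewrite !ltr_norml => /andP[? ?] /andP[? ?] /andP[? ?].
by apply/andP; split; lra.
Qed.

Lemma limit_coercive : uniformly_coercive (Ha a).
Proof.
move=> M; have [K hK] := H_coer (M + 1); exists K => q Kq t x.
have [k hk] := limit_approx x (@ltr01 R).
have := hk t x q; rewrite subrr normr0 ltr01 => /(_ isT).
have := hK q Kq t (x + k%:~R).
by rewrite ltr_norml => h1 /andP[h2 h3]; lra.
Qed.

(** An approximation error of at most 1 inside the modulus is absorbed by doubling its argument:
    [2 + max(Ha, 0) <= 2 (1 + max(Ha, 0))]. The errors outside vanish with [e]. *)
Lemma limit_time_regular : time_regular (Ha a).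
Proof.
have [w [[w0 wmono wlim] Hw]] := H_time.
exists (fun r => w (2 * r)); split.
  split; first by rewrite mulr0.
    by move=> r s r0 rs; apply: wmono; lra.
  apply/cvgrPdist_lt => e e0; move/cvgrPdist_lt : wlim => /(_ e e0).
  rewrite !near_withinE => /nbhs_normP[rho /= rho0 hr].
  apply/nbhs_normP; exists (rho / 2) => /=; first by rewrite divr_gt0.
  move=> r /=; rewrite sub0r normrN => h r0; apply: hr => /=; last by lra.
  by rewrite sub0r normrN normrM ger0_norm//; lra.
move=> t s x p; apply/ler_addgt0Pr => e e0.
pose e' := Num.min 1 (e / 2).
have e'0 : 0 < e' by rewrite lt_min ltr01 divr_gt0.
have e'1 : e' <= 1 by rewrite ge_min lexx.
have e'e : e' <= e / 2 by rewrite ge_min lexx orbT.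
have [k hk] := limit_approx x e'0.
have := hk t x p; have := hk s x p; rewrite subrr normr0 ltr01.
move=> /(_ isT) h1 /(_ isT) h2.
have h3 := Hw t s (x + k%:~R) p.
move: h1 h2; rewrite !ltr_norml => /andP[h11 h12] /andP[h21 h22].
have h4 : w (`|t - s| * (1 + Num.max (H s (x + k%:~R) p) 0)) <=
    w (2 * (`|t - s| * (1 + Num.max (Ha a s x p) 0))).
  have mx : 0 <= Num.max (Ha a s x p) 0 by rewrite le_max lexx orbT.
  have mH : Ha a s x p <= Num.max (Ha a s x p) 0 by rewrite le_max lexx.
  apply: wmono; first by rewrite mulr_ge0// addr_ge0// le_max lexx orbT.
  rewrite mulrCA ler_wpM2l//.
  have : Num.max (H s (x + k%:~R) p) 0 <= Num.max (Ha a s x p) 0 + 1.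
    by rewrite ge_max; apply/andP; split; lra.
  lra.
lra.
Qed.

End Inheritance.

Theorem proposition1p2 (R : realType) (H : R -> R -> R -> R)
    (Ha : side -> R -> R -> R -> R)
    (H_cont : ham_continuous H)
    (H_per : time_periodic H)
    (H_time : time_regular H)
    (H_coer : uniformly_coercive H)
    (H_mono : monotone_outside H)
    (H_asym : asymptotically_periodic H Ha)
    (H_struct : (forall a : side, autonomous_quasiconvex (Ha a)) \/
                (forall a : side, convex_in_gradient (Ha a))) :
  (forall (p : R) (a : side),
     exists! lam : R, ergodic_constant (Ha a) p lam) /\
  (forall (a : side) (Hbar : R -> R),
     (forall p : R, ergodic_constant (Ha a) p (Hbar p)) ->
     [/\ continuous Hbar, coercive Hbar & quasi_convex Hbar]).
Proof.
have Gc a := limit_continuous H_cont H_per H_asym a.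
have Gp a := limit_periodic H_asym a.
have Gco a := limit_coercive H_per H_coer H_asym a.
have Gt a := limit_time_regular H_per H_time H_asym a.
have str a : exists Sh A mix, ergodic_structure (Ha a) Sh A mix /\
    forall th l1 l2, 0 < th -> th < 1 -> mix th l1 l2 <= Num.max l1 l2.
  case: H_struct => /(_ a) h.
    exists quasi_shifts, (fun x => x = 0), (fun _ l1 l2 => Num.max l1 l2).
    split; first exact: (quasiconvex_structure (Gc a) (Gp a) (Gco a) h).
    by move=> th l1 l2 _ _.
  exists convex_shifts, (fun=> True), (fun th l1 l2 => th * l1 + (1 - th) * l2).
  split=> [|th l1 l2 th0 th1].
    exact: (convex_structure (Gc a) (Gp a) (Gco a) h).
  set m := Num.max _ _; have -> : m = th * m + (1 - th) * m by ring.
  apply: lerD; rewrite ler_pM2l ?subr_gt0//; first by rewrite le_max lexx.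
  by rewrite le_max lexx orbT.
split=> [p a|a Hbar hH]; have [Sh [A [mix [ES hmix]]]] := str a.
  have [lam hlam] := ergodic_constant_exists (Gc a) (Gp a) (Gco a) (Gt a) ES p.
  exists lam; split => // l' hl'.
  exact: (ergodic_constant_unique (Gc a) (Gp a) (Gco a) (Gt a) ES hlam hl').
split.
- case: H_struct => /(_ a) h.
    exact: (quasiconvex_effective_continuous (Gc a) (Gp a) (Gco a) (Gt a) hH h).
  exact: (convex_effective_continuous (Gc a) (Gp a) (Gco a) (Gt a) hH h).
- exact: (effective_coercive (Gco a) hH).
- exact: (effective_quasi_convex (Gc a) (Gp a) (Gco a) (Gt a) ES hH hmix).
Qed.
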